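(* Let $m\ge 1$ be an integer and let $\lambda_1,\ldots,\lambda_m$ be rational numbers, none of which is a negative integer, such that $\lambda_i-\lambda_j\notin\mathbb{Z}$ whenever $i\ne j$. Let $K$ denote $\mathbb{Q}$ or an imaginary quadratic field, let $\mathbb{Z}_K$ be its ring of integers, and let $\alpha\in K\setminus\{0\}$, written as $\alpha=a/b$ with $a,b\in\mathbb{Z}_K$. Write $\lambda_j=r_j/s_j$ in lowest terms with $s_j\ge 1$ and put $S=\max_j s_j$. Define \[ d_0=3+3\log 2+5\log S+36S+\log|b|, \] \[ d_1=1+6\log 2+9\log S+36S+\log|b|+2\log\max\{1,|\alpha|\}, \] \[ d_2=2\log S+6S+6S^2 . \] Then there exists a positive constant $H_0$ depending on $\lambda_1,\ldots,\lambda_m,m$ and $\alpha$ such that, for all $(\beta_0,\beta_1,\ldots,\beta_m)\in\mathbb{Z}_K^{m+1}\setminus\{\underline{0}\}$ with $H=\prod_{j=1}^m h_j\ge H_0$, where $h_j=\max\{1,|\beta_j|\}$ $(j=1,\ldots,m)$, \[ \left|\beta_0+\beta_1\varphi_1(\alpha)+\cdots+\beta_m\varphi_m(\alpha)\right|>H^{-1-\frac{6(d_0+d_1m+d_2m^2)}{\log\log H}} . \]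
   Context: For a rational number $\lambda_j$ that is not a negative integer, put $[0]_j=1$ and $[\nu]_j=(1+\lambda_j)(2+\lambda_j)\cdots(\nu+\lambda_j)$ for $\nu\ge1$. The function $\varphi_j=\varphi_{\lambda_j}$ is the entire function \[ \varphi_j(z)=\varphi_{\lambda_j}(z)=\sum_{\nu=0}^\infty\frac{z^\nu}{[\nu]_j},\qquad j=1,\ldots,m. \] The field $K$ is regarded as a subfield of $\mathbb{C}$, and $|\cdot|$ is the usual complex absolute value. *)

(* Defs.v *)
From HB Require Import structures.
From mathcomp Require Import all_boot all_order all_algebra all_field.
From mathcomp Require Import complex.
From mathcomp Require Import all_classical all_reals all_analysis.

Set Implicit Arguments.
Unset Strict Implicit.
Unset Printing Implicit Defensive.

Import Order.TTheory GRing.Theory Num.Theory.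
Import numFieldNormedType.Exports.

Local Open Scope ring_scope.

(* The complex modulus with values in R; the norm `|z| of R[i] is the same
   number seen in R[i]. *)
Definition cmod (R : realType) (z : R[i]) : R := Normc.normc z.

(* [nu] = (1 + lambda) (2 + lambda) ... (nu + lambda), equal to 1 at nu = 0. *)
Definition bracket (lambda : rat) (nu : nat) : rat :=
  \prod_(1 <= k < nu.+1) (k%:R + lambda).

(* R[i]^o is R[i] with the topology of its norm. The series converges for every
   z as soon as lambda is not a negative integer. *)
Definition phi (R : realType) (lambda : rat) (z : R[i]) : R[i] :=
  limn (series (fun nu => z ^+ nu / ratr (bracket lambda nu) : R[i]^o)).

(* The field K is given by an abstract finite extension L of the rationals and
   its embedding iota in the complex numbers. *)
Definition rational_or_imaginary_quadratic (R : realType) (L : fieldExtType rat)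
    (iota : {rmorphism L -> R[i]}) : Prop :=
  \dim {:L} = 1%N
  \/ (\dim {:L} = 2%N /\ exists x : L, iota x \isn't Num.real).

Definition algebraic_integer (L : fieldExtType rat) (x : L) : Prop :=
  integralOver (intr : int -> L) x.

(* denq is the positive denominator of the reduced fraction. *)
Definition max_denom (m : nat) (lambda : 'I_m -> rat) : nat :=
  \max_(j < m) `|denq (lambda j)|%N.

Definition d0 (R : realType) (S : R) (b : R[i]) : R :=
  3 + 3 * ln 2 + 5 * ln S + 36 * S + ln (cmod b).

Definition d1 (R : realType) (S : R) (b alpha : R[i]) : R :=
  1 + 6 * ln 2 + 9 * ln S + 36 * S + ln (cmod b)
  + 2 * ln (Num.max 1 (cmod alpha)).

Definition d2 (R : realType) (S : R) : R :=
  2 * ln S + 6 * S + 6 * S ^+ 2.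

(* Main.v *)
Require Import Defs.
From HB Require Import structures.
From mathcomp Require Import all_boot all_order all_algebra all_field.
From mathcomp Require Import complex.
From mathcomp Require Import all_classical all_reals all_analysis.
From mathcomp Require Import perm.
From mathcomp Require Import zify ring lra.

Set Implicit Arguments.
Unset Strict Implicit.
Unset Printing Implicit Defensive.

Import Order.TTheory GRing.Theory Num.Theory.
Import numFieldNormedType.Exports.

Local Open Scope ring_scope.

(** Write [nu]_j for the bracket of lambda_j, H = h_1 ... h_m, and Lambda for
    the linear form. The proof builds, for each n = (n_1, ..., n_m) and each
    L >= N = n_1 + ... + n_m, explicit simultaneous Pade approximations of the
    phi_j with one common denominator.

    Construction. For a polynomial B(z) = sum_k b_k z^k of degree N, the
    coefficient of z^l in B phi_j is sum_k b_k / [l-k]_j. As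
    1 / [l-k]_j = x (x-1) ... (x-k+1) / [l]_j at x = l + lambda_j, it equals
    P(l + lambda_j) / [l]_j where P(x) = sum_k b_k x (x-1) ... (x-k+1)
    (prod_coef_ge). Choosing for P the polynomial with the zeros
    L + t + lambda_j, 1 <= t <= n_j, and for b_k its Newton coefficients at 0,
    the terms z^l of B phi_j with L < l <= L + n_j vanish; the terms with
    l <= L form the numerator of the approximation to phi_j.

    Arithmetic and size. Multiplication by L! prod_j s_j^(2 n_j) / n_j! and by
    lcm(1, ..., S L + rho), where rho bounds the numerators of the lambda_j,
    makes all coefficients integers. The value of the denominator at alpha is
    then at most A L! W^L, and the j-th remainder at most A L W^L / n_j!, with
    W = growth m S alpha (pade_system).

    Independence. The systems belonging to n and to the m tuples n - e_i form a
    square matrix whose determinant is a nonzero constant times a power of z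
    (det_pade_mx_monomial). Hence some system gives a nonzero combination of
    denominator and numerators with the coefficients beta_j; multiplied by b^L
    it is a nonzero integer of K, of modulus at least 1.

    Conclusion. Put U = W |b|. When n_j! >= 2 m A L U^L h_j for all j, the
    remainders contribute at most 1/2, so |Lambda| >= 1 / (2 A L! U^L)
    (linear_form_ge). If L is least with L! >= H (2 m U^m)^L, the least such n_j
    have sum at most L, and L <= 2 log H / log log H (choose_parameters). Then
    L! U^L exceeds H only by the factor exp(O(L)), which is the factor allowed
    in the statement (log_constants_le).

    The constant H_0 has to serve all fields K containing alpha and all
    representations a / b of alpha. Some positive natural number D makes
    D alpha an algebraic integer, and b can be replaced by D when |b| > D
    (uniform_denominator), so that only bounded values of |b| matter. *)

(** * Least common multiples *)

Definition lcm_upto (n : nat) : nat := (\big[lcmn/1]_(1 <= i < n.+1) i)%N.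

Lemma lcm_upto_gt0 n : (0 < lcm_upto n)%N.
Proof.
rewrite /lcm_upto big_nat; elim/big_ind: _ => // [x y|i /andP[]//].
by rewrite lcmn_gt0 => -> ->.
Qed.

Lemma dvdn_lcm_upto n i : (0 < i <= n)%N -> (i %| lcm_upto n)%N.
Proof.
move=> /andP[i0 ilen]; rewrite /lcm_upto (big_cat_nat (n := i)) //=; last exact: leqW.
rewrite [X in lcmn _ X]big_ltn ?ltnS//.
exact: dvdn_trans (dvdn_lcml _ _) (dvdn_lcmr _ _).
Qed.

Lemma lcm_upto_dvdP n d :
  (forall i, (0 < i <= n)%N -> (i %| d)%N) -> (lcm_upto n %| d)%N.
Proof.
move=> H; rewrite /lcm_upto big_nat; elim/big_ind: _ => // x y xd yd.
by rewrite dvdn_lcm xd.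
Qed.

(** In Legendre's formula the exponent e contributes 1 to (2n)! and 0 to n!, and
    every other exponent at least twice as much to (2n)! as to n!. *)
Lemma dvdn_central_binomial p e n : prime p ->
  (n < p ^ e <= n.*2)%N -> (p %| 'C(n.*2, n))%N.
Proof.
move=> p_pr /andP[ltn len].
have n0 : (0 < n)%N by case: n ltn len => //; rewrite double0 leqn0 expn_eq0; case: p p_pr.
have C0 : (0 < 'C(n.*2, n))%N by rewrite bin_gt0; lia.
have E : ('C(n.*2, n) * (n`! * n`!) = (n.*2)`!)%N.
  by rewrite -[in RHS](bin_fact (n := n.*2) (m := n)); [congr (_ * (_ * _`!))%N; lia|lia].
have /(congr1 (logn p)) := E.
rewrite !lognM ?muln_gt0 ?fact_gt0// !logn_fact// => E2.
have e2 : (e < n.*2.+1)%N.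
  rewrite ltnS; apply: leq_trans len; exact: ltnW (ltn_expl _ (prime_gt1 p_pr)).
have e0 : (0 < e)%N by case: e ltn {len e2} => //; rewrite expn0; lia.
have Hle : (\sum_(1 <= k < n.+1) n %/ p ^ k + \sum_(1 <= k < n.+1) n %/ p ^ k
     < \sum_(1 <= k < n.*2.+1) n.*2 %/ p ^ k)%N.
  have -> : (\sum_(1 <= k < n.+1) n %/ p ^ k = \sum_(1 <= k < n.*2.+1) n %/ p ^ k)%N.
    rewrite [RHS](big_cat_nat (n := n.+1)) //=; last lia.
    rewrite -[LHS]addn0; congr addn; rewrite big_nat big1 // => i /andP[ni _].
    by apply: divn_small; apply: leq_ltn_trans (ltn_expl _ (prime_gt1 p_pr)); apply: ltnW.
  rewrite -big_split /=.
  rewrite [X in (_ < X)%N](bigD1_seq e) ?mem_index_iota ?iota_uniq ?e0//=.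
  rewrite (bigD1_seq e) ?mem_index_iota ?iota_uniq ?e0//=.
  rewrite (divn_small ltn) addn0 add0n -add1n; apply: leq_add.
    by rewrite divn_gt0 // expn_gt0 prime_gt0.
  apply: leq_sum => i _; rewrite leq_divRL ?expn_gt0 ?prime_gt0//.
  by rewrite -addnn mulnDl leq_add ?leq_trunc_div.
have : (0 < logn p 'C(n.*2, n))%N by lia.
by rewrite logn_gt0 mem_primes => /and3P[].
Qed.

(** If a prime power p^e lies between n and 2n, then p^(e-1) <= n, and the
    missing factor p divides the central binomial coefficient. *)
Lemma lcm_upto_double n : (lcm_upto n.*2 %| lcm_upto n * 'C(n.*2, n))%N.
Proof.
apply: lcm_upto_dvdP => i /andP[i0 il].
apply/dvdn_partP => // p; rewrite mem_primes => /and3P[p_pr _ pi].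
rewrite p_part; set e := logn p i.
have e0 : (0 < e)%N by rewrite logn_gt0 mem_primes p_pr i0.
have pe : (p ^ e <= n.*2)%N by apply: leq_trans (dvdn_leq i0 _) il; exact: pfactor_dvdnn.
have [len|ltn] := leqP (p ^ e) n.
  by apply/dvdn_mulr/dvdn_lcm_upto; rewrite expn_gt0 prime_gt0.
rewrite -(prednK e0) expnSr dvdn_mul //; last first.
  by apply: (@dvdn_central_binomial p e) => //; rewrite ltn.
apply: dvdn_lcm_upto; rewrite expn_gt0 prime_gt0//=.
rewrite -leq_double (leq_trans _ pe)// -{2}(prednK e0) expnS -mul2n.
by rewrite leq_mul2r prime_gt1 ?orbT.
Qed.

Lemma bin_le_exp2 n k : ('C(n, k) <= 2 ^ n)%N.
Proof.
elim: n k => [|n IH] [|k]; rewrite ?bin0 ?expn_gt0//.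
by rewrite binS expnS mul2n -addnn leq_add.
Qed.

(** In a strong induction lcm_upto_double turns 16^k into 64^k = 8^(2k); the slack
    between 8 and 16 pays for rounding an odd argument up to an even one. *)
Lemma lcm_upto_le n : (lcm_upto n <= 16 ^ n)%N.
Proof.
have step k : (lcm_upto k <= 16 ^ k -> lcm_upto k.*2 <= 64 ^ k)%N.
  move=> H; apply: leq_trans (dvdn_leq _ (lcm_upto_double k)) _.
    by rewrite muln_gt0 lcm_upto_gt0 bin_gt0; lia.
  have -> : (64 ^ k = 16 ^ k * 2 ^ k.*2)%N.
    by rewrite -mul2n expnM -expnMn.
  by apply: leq_mul H (bin_le_exp2 _ _).
elim/ltn_ind: n => n IH.
have [n1|n1] := leqP n 1.
  by case: n n1 IH => [|[]]// _ _; rewrite /lcm_upto ?big_nil ?big_nat1.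
have [|] := boolP (odd n) => nodd; last first.
  have {1}-> : n = n./2.*2 by lia.
  apply: leq_trans (step _ (IH _ _)) _; first lia.
  have {2}-> : n = (2 * n./2)%N by lia.
  by rewrite expnM leq_exp2r //; lia.
have n3 : (3 <= n)%N by lia.
apply: (@leq_trans (lcm_upto (n./2.+1).*2)).
  apply: dvdn_leq (lcm_upto_gt0 _) _; apply: lcm_upto_dvdP => i /andP[i0 il].
  by apply: dvdn_lcm_upto; lia.
apply: leq_trans (step _ (IH _ _)) _; first lia.
have {2}-> : n = (2 * n./2 + 1)%N by lia.
rewrite expnD expnM; have : (0 < n./2)%N by lia.
move: n./2 => k k0; rewrite expn1 (_ : (16 ^ 2 = 64 * 4)%N)// expnMn expnS.
have : (4 ^ 1 <= 4 ^ k)%N by rewrite leq_exp2l.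
by rewrite expn1 => H; rewrite mulnC -mulnA leq_mul2l; apply/orP; right; lia.
Qed.

(** * Factorials and arithmetic progressions *)

(** With f_n(x) = n! / (x (x+1) ... (x+n)) one has f_(n+1)(x) = f_n(x) - f_n(x+1),
    so the integrality of g f_0 at x, ..., x + n is inherited by g f_n(x). This
    is the partial fraction decomposition of f_n without its coefficients. *)
Lemma fact_div_prod_int (g : rat) n (x : rat) :
  (forall t, (t <= n)%N -> x + t%:R != 0) ->
  (forall t, (t <= n)%N -> g / (x + t%:R) \is a Num.int) ->
  g * n`!%:R / \prod_(0 <= t < n.+1) (x + t%:R) \is a Num.int.
Proof.
elim: n x => [|n IH] x nz Hg.
  by rewrite big_nat1 fact0 mulr1 Hg.
have shift t : x + 1 + t%:R = x + t.+1%:R by rewrite -[t.+1%:R]natr1; ring.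
pose p : rat := \prod_(1 <= t < n.+1) (x + t%:R).
have pE : \prod_(0 <= t < n) (x + t.+1%:R) = p by rewrite /p big_add1.
have p0 : p != 0.
  rewrite /p prodf_seq_neq0; apply/allP => t; rewrite mem_index_iota => /andP[_ tn].
  by apply/implyP => _; apply: nz; lia.
have x0 : x != 0 by have := nz 0%N isT; rewrite addr0.
have xn0 := nz n.+1 (leqnn _).
have -> : g * (n.+1)`!%:R / \prod_(0 <= t < n.+2) (x + t%:R) =
  g * n`!%:R / \prod_(0 <= t < n.+1) (x + t%:R) -
  g * n`!%:R / \prod_(0 <= t < n.+1) (x + 1 + t%:R).
  rewrite (eq_bigr _ (fun t _ => shift t)).
  rewrite [in RHS]big_ltn // [in X in _ = X - _]addr0 -/p.
  rewrite [in LHS]big_nat_recr //= [in LHS]big_ltn // addr0 -/p.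
  rewrite [X in _ = _ - _ / X]big_nat_recr //= pE.
  rewrite factS natrM.
  have -> : n.+1%:R = (x + n.+1%:R) - x by ring.
  field; rewrite p0 x0 !andbT.
  by have -> : x + (x + (1 + n%:R) - x) = x + n.+1%:R by ring.
rewrite rpredB ?IH // => t tn; rewrite ?shift ?nz ?Hg //; lia.
Qed.

(** Modulo n! one may assume x >= 0, where the product is a falling factorial. *)
Lemma fact_dvd_prod_consecutive n (x : int) : (n`!%:Z %| \prod_(t < n) (x + t%:Z))%Z.
Proof.
have f0 : n`!%:Z != 0 by rewrite -lt0n fact_gt0.
pose y := `|(x %% n`!)%Z|%N.
have yE : y%:Z = (x %% n`!)%Z by rewrite /y gez0_abs ?modz_ge0.
have H : (\prod_(t < n) (x + t%:Z) == \prod_(t < n) (y%:Z + t%:Z) %[mod n`!%:Z])%Z.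
  elim/big_ind2: _ => // [a b c d /eqP ab /eqP cd|i _].
    by apply/eqP; rewrite -modzMml ab modzMml -modzMmr cd modzMmr.
  by apply/eqP; rewrite yE modzDml.
apply/dvdz_mod0P; rewrite (eqP H); apply/dvdz_mod0P.
rewrite -(big_morph Posz PoszM (erefl _)) -?PoszD.
have -> : (\prod_(t < n) (y + t) = (y + n).-1 ^_ n)%N.
  rewrite ffact_prod (reindex_inj rev_ord_inj) /=.
  by apply: eq_bigr => i _; have := ltn_ord i; lia.
by rewrite -bin_ffact dvdzE /= dvdn_mull.
Qed.

Lemma logn_fact_le p n : prime p -> (logn p n`! <= n)%N.
Proof.
move=> p_pr; rewrite logn_fact //.
have p1 := prime_gt1 p_pr.
suff H : forall k, (\sum_(1 <= i < k.+1) n %/ p ^ i + n %/ p ^ k <= n)%N.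
  by apply: leq_trans (H n); apply: leq_addr.
elim=> [|k IH]; first by rewrite big_nil expn0 divn1.
rewrite big_nat_recr //= -addnA; apply: leq_trans IH; rewrite leq_add2l.
rewrite expnSr divnMA; move: (n %/ p ^ k)%N => x.
by rewrite addnn -mul2n; apply: leq_trans (leq_trunc_div x p); rewrite mulnC leq_mul2l p1 orbT.
Qed.

(** The part of n! made of primes dividing s divides s^n because v_p(n!) <= n.
    Modulo the complementary part, s is invertible and the progression is s^n
    times a product of consecutive integers. *)
Lemma fact_dvd_arith_prod n (s : nat) (r : int) : (0 < s)%N ->
  (n`!%:Z %| s%:Z ^+ n * \prod_(t < n) (r + s%:Z * t%:Z))%Z.
Proof.
move=> s0; have f0 := fact_gt0 n.
rewrite -(partnC \pi(s) f0) PoszM dvdz_mul //.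
  rewrite dvdzE /= abszX /=; apply/dvdn_partP; first exact: part_gt0.
  move=> p; rewrite mem_primes => /and3P[p_pr _ pd].
  rewrite p_part pfactor_dvdn ?expn_gt0 ?s0//.
  have ps : p \in \pi(s).
    by apply: (pnatP _ _ (part_pnat \pi(s) n`!)) => //; rewrite part_gt0.
  rewrite lognX; apply: leq_trans (dvdn_leq_log p f0 (dvdn_part _ _)) _.
  apply: leq_trans (logn_fact_le n p_pr) _.
  by rewrite leq_pmulr // logn_gt0.
set A := (n`!`_(\pi(s)^'))%N; have A0 : (0 < A)%N by exact: part_gt0.
have cop : coprime s A.
  by have := pnat_coprime (pnat_pi s0) (part_pnat (\pi(s))^' n`!).
have [[u v] /= uv] : exists uv : int * int, uv.1 * s%:Z + uv.2 * A%:Z = 1.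
  by apply/coprimezP.
have H : (\prod_(t < n) (r + s%:Z * t%:Z) = \prod_(t < n) (s%:Z * (u * r + t%:Z)) %[mod A])%Z.
  elim/big_ind2: _ => // [a b c d ab cd|i _].
    by rewrite -modzMml ab modzMml -modzMmr cd modzMmr.
  have -> : r + s%:Z * i%:Z = (v * r) * A%:Z + s%:Z * (u * r + i%:Z).
    by rewrite -{1}[r]mulr1 -uv; ring.
  by rewrite modzMDl.
apply/dvdz_mod0P; rewrite H; apply/dvdz_mod0P.
rewrite big_split /= dvdz_mull //; apply: dvdz_trans (fact_dvd_prod_consecutive n _).
by rewrite dvdzE /= dvdn_part.
Qed.

(** * Newton interpolation at the natural numbers *)

(** Differencing the function before recursing makes integrality and size of
    iterated differences immediate inductions. *)
Fixpoint fdiff (k : nat) (f : nat -> rat) : nat -> rat :=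
  if k is k'.+1 then fdiff k' (fun x => f x.+1 - f x) else f.

(** f (x + n + 1) is the sum of f and its difference at x + n; Pascal's rule does
    the rest. *)
Lemma newton_forward n (f : nat -> rat) x :
  f (x + n)%N = \sum_(k < n.+1) 'C(n, k)%:R * fdiff k f x.
Proof.
elim: n f x => [|n IH] f x; first by rewrite big_ord_recl big_ord0 bin0 mul1r addr0 addn0.
have IHd := IH (fun x => f x.+1 - f x) x.
rewrite addnS (_ : f _ = (f (x + n).+1 - f (x + n)%N) + f (x + n)%N); last by rewrite subrK.
rewrite {}IHd IH [RHS]big_ord_recl bin0 mul1r.
under [in RHS]eq_bigr do rewrite lift0 /= binS natrD mulrDl.
rewrite big_split /= [in RHS]addrA [RHS]addrC; congr (_ + _).
rewrite [LHS]big_ord_recl bin0 mul1r; congr (_ + _).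
by rewrite [RHS]big_ord_recr /= bin_small // mul0r addr0.
Qed.

Lemma fdiff_int k (f : nat -> rat) x :
  (forall i, f i \is a Num.int) -> fdiff k f x \is a Num.int.
Proof. by elim: k f => [|k IH] f H //=; apply: IH => i; rewrite rpredB. Qed.

Lemma fdiffZ k (c : rat) (f : nat -> rat) x :
  fdiff k (fun i => c * f i) x = c * fdiff k f x.
Proof.
elim: k f => [|k IH] f //=; rewrite -IH; congr (fdiff k _ x).
by apply/funext => i; rewrite mulrBr.
Qed.

Lemma fdiff_le k (f : nat -> rat) x (M : rat) :
  (forall i, (i <= x + k)%N -> `|f i| <= M) -> `|fdiff k f x| <= 2 ^+ k * M.
Proof.
elim: k f M => [|k IH] f M H /=; first by rewrite mul1r H ?addn0.
rewrite exprSr -mulrA; apply: IH => i ile.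
rewrite mulr_natl mulr2n; apply: le_trans (ler_normB _ _) _.
by rewrite lerD ?H //; lia.
Qed.

Definition ffact_poly (k : nat) : {poly rat} := \prod_(i < k) ('X - i%:R%:P).

Lemma size_ffact_poly k : size (ffact_poly k) = k.+1.
Proof. by rewrite size_prod_XsubC /index_enum unlock -enumT size_enum_ord. Qed.

Lemma horner_ffact_poly_nat k n : (ffact_poly k).[n%:R] = (n ^_ k)%:R.
Proof.
rewrite horner_prod; under eq_bigr do rewrite hornerXsubC.
have [kn|nk] := leqP k n.
  rewrite ffact_prod natr_prod; apply: eq_bigr => i _; rewrite natrB //.
  by apply: leq_trans kn; apply: ltnW.
by rewrite ffact_small //; apply/eqP; rewrite prodf_seq_eq0; apply/hasP;
   exists (Ordinal nk); rewrite ?mem_index_enum //= subrr.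
Qed.

(** Both sides have degree at most N and agree at 0, ..., N by newton_forward. *)
Lemma newton_interpolation N (p : {poly rat}) : (size p <= N.+1)%N ->
  p = \sum_(k < N.+1) (fdiff k (fun i => p.[i%:R]) 0%N / k`!%:R) *: ffact_poly k.
Proof.
move=> sp; set q := (X in _ = X); apply/subr0_eq.
have sq : (size q <= N.+1)%N.
  apply: leq_trans (size_sum _ _ _) _; apply/bigmax_leqP => i _.
  by apply: leq_trans (size_scale_leq _ _) _; rewrite size_ffact_poly.
apply: (@roots_geq_poly_eq0 _ _ [seq i%:R | i <- iota 0 N.+1]).
- apply/allP => y /seq.mapP [] i; rewrite mem_iota /= add0n ltnS => iN ->.
  rewrite /root hornerD hornerN subr_eq0 /q horner_sum.
  have /= := newton_forward i (fun i => p.[i%:R]) 0.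
  rewrite add0n => ->.
  rewrite (big_ord_widen N.+1
    (fun k => 'C(i, k)%:R * fdiff k (fun i0 : nat => p.[i0%:R]) 0%N)) ?ltnS//.
  rewrite [X in _ == X](bigID (fun k : 'I_N.+1 => (k < i.+1)%N)) /=.
  rewrite [X in _ == _ + X]big1 ?addr0; last first.
    move=> k; rewrite -leqNgt => ik.
    by rewrite hornerZ horner_ffact_poly_nat ffact_small ?mulr0.
  apply/eqP/eq_bigr => k _; rewrite hornerZ horner_ffact_poly_nat -bin_ffact natrM.
  by field; rewrite pnatr_eq0 -lt0n fact_gt0.
- by rewrite map_inj_uniq ?iota_uniq // => i j /eqP; rewrite eqr_nat => /eqP.
- rewrite size_map size_iota; apply: leq_trans (size_polyD _ _) _.
  by rewrite size_polyN geq_max sp sq.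
Qed.

(** * Pade polynomials *)

Section Pade.
Variables (m : nat) (lambda : 'I_m -> rat) (n : 'I_m -> nat) (L : nat).

(** These zeros are the points at which a vanishing value annihilates the
    coefficients of index L + 1, ..., L + n_j of the product with phi_j. *)
Definition pade_zeros : {poly rat} :=
  \prod_j \prod_(t < n j) ('X - ((L + t.+1)%:R + lambda j)%:P).

Definition pade_deg : nat := (\sum_j n j)%N.

Definition newton_coef (k : nat) : rat :=
  fdiff k (fun i => pade_zeros.[i%:R]) 0%N / k`!%:R.

Definition pade_den : {poly rat} := \poly_(k < pade_deg.+1) newton_coef k.

(** The coefficient of z^l in the product of pade_den with the series phi_mu. *)
Definition prod_coef (mu : rat) (l : nat) : rat :=
  \sum_(k < pade_deg.+1 | (k <= l)%N) newton_coef k / bracket mu (l - k).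

Definition pade_num (mu : rat) : {poly rat} := \poly_(l < L.+1) prod_coef mu l.

Lemma size_pade_zeros : size pade_zeros = pade_deg.+1.
Proof.
rewrite /pade_zeros /pade_deg size_prod.
  have -> : (\sum_j size (\prod_(t < n j) ('X - ((L + t.+1)%:R + lambda j)%:P))%R =
             \sum_j (n j + 1))%N.
    by apply: eq_bigr => j _; rewrite size_prod_XsubC /index_enum unlock -enumT size_enum_ord addn1.
  by rewrite big_split /= sum1_card -addSn addnK.
by move=> j _; rewrite prodf_seq_neq0; apply/allP => t _; rewrite polyXsubC_eq0.
Qed.

End Pade.

Lemma bracketD mu l k : (k <= l)%N ->
  bracket mu l = bracket mu (l - k) * (ffact_poly k).[l%:R + mu].
Proof.
elim: k l => [|k IH] [|l]// kl; rewrite ?subn0 ?subSS /ffact_poly ?big_ord0 ?hornerC ?mulr1//.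
rewrite /bracket big_nat_recr //= -/(bracket mu l) (IH l) //.
rewrite -/(bracket mu (l - k)) -mulrA; congr (_ * _).
rewrite [in RHS]big_ord_recl hornerM mulrC hornerXsubC subr0; congr (_ * _).
rewrite /ffact_poly !horner_prod; apply: eq_bigr => i _.
by rewrite !hornerXsubC lift0 -!natr1; ring.
Qed.

(** By bracketD the sum is Newton's expansion of pade_zeros at l + mu. *)
Lemma prod_coef_ge m (lambda : 'I_m -> rat) n L mu l :
  (forall nu, bracket mu nu != 0) -> (pade_deg n <= l)%N ->
  prod_coef lambda n L mu l = (pade_zeros lambda n L).[l%:R + mu] / bracket mu l.
Proof.
move=> nz Nl; rewrite [in RHS](newton_interpolation (N := pade_deg n) (p := pade_zeros _ _ _)).
  rewrite horner_sum mulr_suml /prod_coef; apply: eq_big => [k|k _].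
    by rewrite (leq_trans _ Nl) // -ltnS.
  have kl : (k <= l)%N by rewrite (leq_trans _ Nl) // -ltnS.
  rewrite hornerZ -/(newton_coef _ _ _ _) -mulrA; congr (_ * _).
  have := nz l; rewrite (bracketD mu kl) mulf_eq0 negb_or => /andP[h1 h2].
  by field; rewrite h1 h2.
by rewrite size_pade_zeros.
Qed.

(** * The determinant of the Pade systems *)

Lemma size_det_leq (R : idomainType) k (M : 'M[{poly R}]_k) (d : 'I_k -> nat) :
  (forall i j, (size (M i j) <= (d j).+1)%N) ->
  (size (\det M) <= (\sum_j d j).+1)%N.
Proof.
move=> Hd; rewrite /determinant.
apply: leq_trans (size_sum _ _ _) _; apply/bigmax_leqP => s _.
rewrite -signr_odd mulr_sign; apply: (@leq_trans (size (\prod_i M i (s i))%R)).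
  by case: ifP; rewrite ?size_polyN.
apply: leq_trans (size_poly_prod_leq _ _) _.
rewrite [leqRHS](_ : _ = (\sum_i d (s i)).+1); last first.
  by rewrite [in LHS](reindex_inj (@perm_inj _ s)).
have H : (\sum_(i < k) size (M i (s i)) <= \sum_i (d (s i) + 1))%N.
  by apply: leq_sum => i _; rewrite addn1 Hd.
rewrite big_split /= sum1_card card_ord in H; rewrite card_ord leq_subLR addnS ltnS addnC; exact: H.
Qed.

Lemma pade_deg_ge m (n : 'I_m -> nat) L j : (pade_deg n <= L)%N -> (n j <= L)%N.
Proof. by apply: leq_trans; rewrite /pade_deg (bigD1 j) //= leq_addr. Qed.

Section Det.
Variables (m : nat) (lambda : 'I_m -> rat) (n : 'I_m -> nat) (L : nat).
Hypothesis nz : forall j nu, bracket (lambda j) nu != 0.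
Hypothesis lambda_diff : forall i j, i != j -> lambda i - lambda j \isn't a Num.int.
Hypothesis n_gt0 : forall j, (0 < n j)%N.
Hypothesis sum_n : (pade_deg n <= L)%N.

(** Index 0 stands for n itself and the other indices for n with one entry
    lowered by 1: m + 1 systems with the same L, as many as the linear
    form has terms. *)
Definition shifted (i : 'I_m.+1) (j : 'I_m) : nat := (n j - (i == lift ord0 j))%N.

Definition pade_mx : 'M[{poly rat}]_m.+1 := \matrix_(i, j)
  if unlift ord0 j is Some j' then pade_num lambda (shifted i) L (lambda j')
  else pade_den lambda (shifted i) L.

Lemma shifted_le i : (pade_deg (shifted i) <= pade_deg n)%N.
Proof. by apply: leq_sum => j _; apply: leq_subr. Qed.

Lemma pade_zeros_root n' j t : (t < n' j)%N ->
  (pade_zeros lambda n' L).[(L + t.+1)%:R + lambda j] = 0.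
Proof.
move=> tn; rewrite /pade_zeros (bigD1 j) //= hornerM (bigD1 (Ordinal tn)) //= !hornerM.
by rewrite hornerXsubC subrr !mul0r.
Qed.

Lemma pade_zeros_neq0 n' j : (pade_zeros lambda n' L).[(L + (n' j).+1)%:R + lambda j] != 0.
Proof.
rewrite /pade_zeros horner_prod prodf_seq_neq0; apply/allP => i _; apply/implyP => _.
rewrite horner_prod prodf_seq_neq0; apply/allP => t _; apply/implyP => _.
rewrite hornerXsubC; have [ij|ij] := eqVneq i j.
  subst i; rewrite opprD addrACA subrr addr0 subr_eq0 eqr_nat; have := ltn_ord t; lia.
apply: contraNneq (lambda_diff ij) => H.
have -> : lambda i - lambda j = (L + (n' j).+1)%:R - (L + t.+1)%:R.
  by apply/subr0_eq; rewrite -[RHS]oppr0 -H; ring.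
by rewrite rpredB // rpred_nat.
Qed.

Lemma pade_zeros0_neq0 n' : (pade_zeros lambda n' L).[0] != 0.
Proof.
rewrite /pade_zeros horner_prod prodf_seq_neq0; apply/allP => j _; apply/implyP => _.
rewrite horner_prod prodf_seq_neq0; apply/allP => t _; apply/implyP => _.
rewrite hornerXsubC sub0r oppr_eq0; have := nz j (L + t.+1).
by rewrite addnS /bracket big_nat_recr //= mulf_eq0 negb_or => /andP[_].
Qed.

(** Degree 2L suffices to see every coefficient up to index L + n_j. *)
Definition phi_trunc (mu : rat) : {poly rat} := \poly_(nu < L.*2.+1) (bracket mu nu)^-1.

Lemma coef_den_phi n' mu l : (l <= L.*2)%N ->
  (pade_den lambda n' L * phi_trunc mu)`_l = prod_coef lambda n' L mu l.
Proof.
move=> lL; rewrite coefM /prod_coef.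
under eq_bigr => k _.
  rewrite /pade_den /phi_trunc !coef_poly.
  rewrite (_ : (l - k < L.*2.+1)%N); last by rewrite ltnS (leq_trans (leq_subr _ _)).
  over.
rewrite (big_ord_widen_cond (maxn l.+1 (pade_deg n').+1)
  (fun=> true) (fun k => (if (k < (pade_deg n').+1)%N then newton_coef lambda n' L k else 0) *
   (bracket mu (l - k))^-1)) ?leq_maxl //.
rewrite (big_ord_widen_cond (maxn l.+1 (pade_deg n').+1)
  (fun k => k <= l)%N (fun k => newton_coef lambda n' L k / bracket mu (l - k))) ?leq_maxr //.
rewrite (bigID (fun k : 'I__ => (k < (pade_deg n').+1)%N)) /= [X in _ + X]big1 ?addr0; last first.
  by move=> k /andP[_ /negPf->]; rewrite mul0r.
by apply: eq_big => [k|k /andP[_ ->]].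
Qed.

Definition pade_rem (i : 'I_m.+1) (j : 'I_m) : {poly rat} :=
  pade_den lambda (shifted i) L * phi_trunc (lambda j) -
  pade_num lambda (shifted i) L (lambda j).

Lemma coef_pade_rem_ge i j l : (L < l <= L.*2)%N ->
  (pade_rem i j)`_l = (pade_zeros lambda (shifted i) L).[l%:R + lambda j] / bracket (lambda j) l.
Proof.
move=> /andP[Ll lL]; rewrite coefB coef_den_phi // coef_poly ltnS leqNgt Ll subr0.
rewrite prod_coef_ge //; apply: leq_trans (ltnW Ll).
exact: leq_trans (shifted_le i) sum_n.
Qed.

Lemma coef_pade_rem_lt i j l : (l < L + n j)%N -> (pade_rem i j)`_l = 0.
Proof.
move=> ll; have [lL|Ll] := leqP l L.
  by rewrite coefB coef_den_phi ?coef_poly ?ltnS ?lL ?subrr//; lia.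
rewrite coef_pade_rem_ge; last by have := pade_deg_ge j sum_n; lia.
rewrite -(subnKC Ll) addSnnS pade_zeros_root ?mul0r // /shifted.
by case: eqP => _ /=; lia.
Qed.

(** L + n_j + lambda_j is a zero for every system except the one in which n_j
    was lowered, and there all differences of zeros are nonzero since no
    lambda_i - lambda_j is an integer. *)
Lemma coef_pade_rem_first_eq0 i j :
  ((pade_rem i j)`_(L + n j) == 0) = (i != lift ord0 j).
Proof.
have nj := n_gt0 j.
rewrite coef_pade_rem_ge; last by have := pade_deg_ge j sum_n; lia.
rewrite mulf_eq0 invr_eq0 (negPf (nz _ _)) orbF -(prednK nj).
have [->|ne] /= := eqVneq i (lift ord0 j).
  have := pade_zeros_neq0 (shifted (lift ord0 j)) j.
  by rewrite {2}/shifted eqxx subn1 => /negPf.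
by rewrite pade_zeros_root ?eqxx // /shifted (negPf ne) subn0 (prednK nj).
Qed.

(** Multiplication by a unitriangular matrix (up to sign) replaces numerators by
    remainders, so the determinant is divisible by X^(m L + N); its degree is at
    most m L + N. The constant quotient is nonzero: at 0 it is the determinant
    of a triangular matrix with nonzero diagonal. *)
Lemma det_pade_mx_monomial : exists c, exists2 K, c != 0 & \det pade_mx = c *: 'X^K.
Proof.
(* E performs the column operations, dg collects the orders of vanishing at 0,
   and T is what remains of the matrix of denominators and remainders. *)
pose E : 'M[{poly rat}]_m.+1 := \matrix_(i, j)
  if unlift ord0 i is Some i' then (- (i == j)%:R)
  else if unlift ord0 j is Some j' then phi_trunc (lambda j') else 1.
pose T : 'M[{poly rat}]_m.+1 := \matrix_(i, j)
  if unlift ord0 j is Some j' then drop_poly (L + n j') (pade_rem i j')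
  else pade_den lambda (shifted i) L.
pose dg : 'rV[{poly rat}]_m.+1 := \row_j
  if unlift ord0 j is Some j' then 'X^(L + n j') else 1.
have ME : pade_mx *m E = T *m diag_mx dg.
  apply/matrixP => i j; rewrite mul_mx_diag !mxE big_ord_recl !mxE unlift_none.
  case: unliftP => [j' ->|->].
    rewrite (bigD1 j') //= !mxE !liftK eqxx mulrN1 big1 ?addr0; last first.
      move=> k kj; rewrite !mxE !liftK (inj_eq lift_inj) (negPf kj) oppr0 mulr0 //.
    rewrite -/(pade_rem i j').
    rewrite -[LHS](poly_take_drop (L + n j')).
    suff -> : take_poly (L + n j') (pade_rem i j') = 0 by rewrite add0r.
    apply/polyP => l; rewrite coef_take_poly coef0.
    by case: ifP => // /coef_pade_rem_lt ->.
  rewrite !mulr1 big1 ?addr0 // => k _.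
  by rewrite !mxE !liftK oppr0 mulr0.
have detE : \det E = (-1) ^+ m.
  rewrite -det_tr det_trig; last first.
    apply/is_trig_mxP => i j ij; rewrite !mxE.
    case: unliftP => [j' jE|jE]; last by move: ij; rewrite jE.
    by rewrite -val_eqE /= gtn_eqF ?oppr0.
  rewrite big_ord_recl !mxE !unlift_none mul1r.
  under eq_bigr do rewrite !mxE liftK eqxx.
  by rewrite prodr_const card_ord.
have detdg : \det (diag_mx dg) = 'X^(m * L + pade_deg n).
  rewrite det_diag big_ord_recl !mxE unlift_none mul1r.
  under eq_bigr do rewrite !mxE liftK.
  by rewrite prodrXr big_split /= sum_nat_const card_ord.
have detT0 : (\det T).[0] != 0.
  have -> : (\det T).[0] = \det (map_mx (horner_eval 0) T) by rewrite det_map_mx.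
  rewrite det_trig; last first.
    apply/is_trig_mxP => i j ij; rewrite !mxE.
    case: unliftP => [j' jE|jE]; last by move: ij; rewrite jE.
    rewrite /horner_eval horner_coef0 coef_drop_poly add0n; apply/eqP.
    by rewrite coef_pade_rem_first_eq0 -jE -val_eqE /= ltn_eqF.
  rewrite prodf_seq_neq0; apply/allP => i _; apply/implyP => _; rewrite !mxE.
  case: unliftP => [j ->|->].
    by rewrite /horner_eval horner_coef0 coef_drop_poly add0n coef_pade_rem_first_eq0 negbK.
  rewrite /horner_eval horner_coef0 coef_poly /= /newton_coef fact0 divr1 /=.
  exact: pade_zeros0_neq0.
have detMT : \det pade_mx = (-1) ^+ m * (\det T * 'X^(m * L + pade_deg n)).
  have := congr1 determinant ME; rewrite !det_mulmx detE detdg => <-.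
  by rewrite mulrCA -signr_odd -expr2 sqrr_sign mulr1.
have sz : (size (\det pade_mx) <= (m * L + pade_deg n).+1)%N.
  have := @size_det_leq _ _ pade_mx (fun j => if unlift ord0 j is Some _ then L else pade_deg n).
  rewrite big_ord_recl unlift_none.
  under eq_bigr do rewrite liftK.
  rewrite sum_nat_const card_ord addnC; apply => i j; rewrite !mxE.
  case: unliftP => [j' _|_]; first exact: size_poly.
  apply: leq_trans (size_poly _ _) _; rewrite ltnS; exact: shifted_le.
have T0 : \det T != 0 by apply: contraNneq detT0 => ->; rewrite horner0.
have sT : (size (\det T) <= 1)%N.
  have szs (b : bool) (p : {poly rat}) : size (if b then - p else p) = size p.
    by case: b; rewrite // size_polyN.
  by move: sz; rewrite detMT -signr_odd mulr_sign szs size_mulXn // -[X in (_ <= X)%N]addn1 leq_add2l.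
exists ((-1) ^+ m * (\det T)`_0), (m * L + pade_deg n)%N.
  by rewrite mulf_neq0 ?signr_eq0 // -horner_coef0.
rewrite detMT; move: ((\det T)`_0) (size1_polyC sT) => c ->.
rewrite mul_polyC -scalerA -![(-1) ^+ m]signr_odd mulr_sign.
by case: odd; rewrite ?expr1 ?expr0 ?scaleN1r ?scale1r.
Qed.

End Det.

(** * Denominators and sizes of the coefficients *)

Lemma exprM_prod (k : nat) (c : rat) (f : 'I_k -> rat) :
  c ^+ k * \prod_(t < k) f t = \prod_(t < k) (c * f t).
Proof. by rewrite big_split prodr_const card_ord. Qed.

Section Arith.
Variables (m : nat) (lambda : 'I_m -> rat) (S rho : nat).
Hypothesis nz : forall j nu, bracket (lambda j) nu != 0.
Hypothesis S_ge1 : (1 <= S)%N.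
Hypothesis den_le : forall j, (`|denq (lambda j)| <= S)%N.
Hypothesis num_le : forall j, (`|numq (lambda j)| <= rho)%N.

Lemma den_abs j : (denq (lambda j)) = `|denq (lambda j)|%N.
Proof. by rewrite gez0_abs ?denq_ge0. Qed.

(** One factor s^n clears the denominators of the values of pade_zeros, and the
    other one the part of n! made of primes dividing s. *)
Definition weight (n : 'I_m -> nat) : rat :=
  \prod_j ((denq (lambda j))%:~R ^+ (2 * n j) / (n j)`!%:R).

Lemma weight_zeros_int n L (x : int) :
  weight n * (pade_zeros lambda n L).[x%:~R] \is a Num.int.
Proof.
rewrite /weight /pade_zeros horner_prod -big_split rpred_prod // => j _ /=.
set s := denq (lambda j); set r := numq (lambda j).
have s0 : (s%:~R : rat) != 0 by rewrite intr_eq0 denq_neq0.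
pose y : int := r - s * (x - (L.+1)%:Z).
have E : (s%:~R : rat) ^+ n j * (\prod_(t < n j) ('X - ((L + t.+1)%:R + lambda j)%:P)).[x%:~R]
    = (-1) ^+ n j * (\prod_(t < n j) (y + s * t%:Z))%:~R.
  rewrite horner_prod rmorph_prod /= !exprM_prod; apply: eq_bigr => t _.
  rewrite hornerXsubC mulrBr mulrDr [_ * lambda j]mulrC -numqE -/r.
  by rewrite /y !(intrD, intrM, intrN) -!pmulrn natrD -[L.+1%:R]natr1 -[t.+1%:R]natr1; ring.
set p := horner _ _ in E *.
have s1 : (0 < `|s|)%N by rewrite absz_gt0 denq_neq0.
have [q qE] : exists q : int, s ^+ n j * \prod_(t < n j) (y + s * t%:Z) = q * (n j)`!%:Z.
  by apply/dvdzP; have := fact_dvd_arith_prod (n j) y s1; rewrite -den_abs.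
have f0 : ((n j)`!%:R : rat) != 0 by rewrite pnatr_eq0 -lt0n fact_gt0.
have -> : (s%:~R : rat) ^+ (2 * n j) / (n j)`!%:R * p = (-1) ^+ n j * q%:~R.
  rewrite mul2n -addnn exprD.
  have := congr1 (intr : int -> rat) qE; rewrite !intrM rmorphXn /= => qE'.
  by apply: (mulIf f0); rewrite -[RHS]mulrA -qE' mulrCA -E; field.
by rewrite rpredM ?rpredX ?rpredN1 // intr_int.
Qed.

(** This is fact_div_prod_int at x = 1 + lambda, as g / (t + lambda) = g s / (s t + r)
    for lambda = r / s. *)
Lemma lcm_bracket_int (G : nat) j nu :
  (forall t, (1 <= t <= nu)%N -> (absz (numq (lambda j) + denq (lambda j) * t%:Z)%R %| G)%N) ->
  G%:R * nu`!%:R / bracket (lambda j) nu \is a Num.int.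
Proof.
case: nu => [|nu] H.
  by rewrite /bracket big_nil fact0 divr1 mulr1 natr_int.
have E t : 1 + lambda j + t%:R = t.+1%:R + lambda j by rewrite -natr1; ring.
have tnz t : (t <= nu)%N -> t.+1%:R + lambda j != 0.
  have := nz j t.+1; rewrite /bracket big_nat_recr //= mulf_eq0 negb_or => /andP[_ ].
  by [].
have : G%:R * nu`!%:R / \prod_(0 <= t < nu.+1) (1 + lambda j + t%:R) \is a Num.int.
  apply: fact_div_prod_int => t tn; rewrite E ?tnz //.
  have d0 : ((denq (lambda j))%:~R : rat) != 0 by rewrite intr_eq0 denq_neq0.
  have dE : (t.+1%:R + lambda j) * (denq (lambda j))%:~R =
    (numq (lambda j) + denq (lambda j) * t.+1%:Z)%:~R.
    by rewrite mulrDl -numqE intrD intrM; ring.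
  have /dvdnP[q qE] := H t.+1 tn.
  have -> : G%:R / (t.+1%:R + lambda j) = G%:R * (denq (lambda j))%:~R /
     (numq (lambda j) + denq (lambda j) * t.+1%:Z)%:~R.
    by rewrite -dE -mulf_div divff ?mulr1.
  have nz' : ((numq (lambda j) + denq (lambda j) * t.+1%:Z)%:~R : rat) != 0.
    by rewrite -dE mulf_neq0 ?tnz.
  move: qE nz'; set v : int := (X in (`|X|)%N) => qE nz'.
  rewrite qE natrM -[`|v|%:R]/(`|v|%:Z%:~R) abszE.
  have [v0|v0] := lerP 0 v.
    by rewrite (ger0_norm v0) mulrAC mulrK ?unitfE // rpredM ?natr_int ?intr_int.
  rewrite (ltr0_norm v0) intrN mulrN mulNr mulNr mulrAC mulrK ?unitfE //.
  by rewrite rpredN rpredM ?natr_int ?intr_int.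
move=> Hi; rewrite factS natrM /bracket big_add1 /=.
rewrite (_ : \prod_(0 <= i < nu.+1) _ = \prod_(0 <= t < nu.+1) (1 + lambda j + t%:R)); last first.
  by apply: eq_bigr => t _; rewrite E.
by rewrite mulrCA -mulrA rpredM // natr_int.
Qed.

Lemma newton_scaled_int n L k : weight n * (k`!%:R * newton_coef lambda n L k) \is a Num.int.
Proof.
rewrite /newton_coef [k`!%:R * _]mulrC divfK ?pnatr_eq0 -?lt0n ?fact_gt0 // -fdiffZ.
by apply: fdiff_int => i; apply: (weight_zeros_int n L i%:Z).
Qed.

Lemma pade_den_coef_int n L k : (k <= L)%N ->
  L`!%:R * weight n * newton_coef lambda n L k \is a Num.int.
Proof.
move=> kL; rewrite -(bin_fact kL) mulnA mulnAC natrM.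
set x := newton_coef _ _ _ _.
have -> : ('C(L, k) * (L - k)`!)%:R * k`!%:R * weight n * x =
  ('C(L, k) * (L - k)`!)%:R * (weight n * (k`!%:R * x)) by ring.
by rewrite rpredM ?natr_int // newton_scaled_int.
Qed.

(** L! splits as an integer times k! (l-k)!, where k! makes the Newton coefficient
    integral and (l-k)!, together with G, the inverse of the bracket. *)
Lemma prod_coef_int (G : nat) n L j l : (l <= L)%N ->
  (forall t, (1 <= t <= L)%N -> (absz (numq (lambda j) + denq (lambda j) * t%:Z)%R %| G)%N) ->
  G%:R * L`!%:R * weight n * prod_coef lambda n L (lambda j) l \is a Num.int.
Proof.
move=> lL HG; rewrite /prod_coef mulr_sumr rpred_sum // => k kl.
rewrite -(bin_fact lL) -(bin_fact kl) !natrM.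
have HGl : G%:R * (l - k)`!%:R / bracket (lambda j) (l - k) \is a Num.int.
  apply: lcm_bracket_int => t /andP[t0 tl]; apply: HG; rewrite t0 (leq_trans tl) //.
  by rewrite (leq_trans (leq_subr _ _)).
set x := newton_coef _ _ _ _; set br := bracket _ _ in HGl *.
have -> : G%:R * ('C(L, l)%:R * ('C(l, k)%:R * (k`!%:R * (l - k)`!%:R) * (L - l)`!%:R)) *
  weight n * (x / br) = 'C(L, l)%:R * 'C(l, k)%:R * (L - l)`!%:R *
   (weight n * (k`!%:R * x)) * (G%:R * (l - k)`!%:R / br) by ring.
apply: rpredM HGl; apply: rpredM; last exact: newton_scaled_int.
by rewrite !rpredM ?natr_int.
Qed.

Lemma lambda_le j : `|lambda j| <= rho%:R.
Proof.
have H1 : 1 <= `|(denq (lambda j))%:~R : rat|.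
  by rewrite -intr_norm -[1]/(1%:~R) ler_int; have := denq_neq0 (lambda j); lia.
have H2 : `|lambda j| * `|(denq (lambda j))%:~R| <= rho%:R.
  by rewrite -normrM -numqE -intr_norm -abszE ler_nat.
by apply: le_trans H2; rewrite ler_peMr.
Qed.

(** (u+1) ... (u+k) is k! times a binomial coefficient of u + k. *)
Lemma prod_le_fact_exp2 (k u : nat) (f : nat -> rat) :
  (forall t, `|f t| <= (u + t.+1)%:R) ->
  \prod_(t < k) `|f t| <= k`!%:R * 2 ^+ (u + k).
Proof.
move=> H; apply: (@le_trans _ _ (\prod_(t < k) (u + t.+1)%:R)).
  by apply: ler_prod => t _; rewrite normr_ge0 H.
rewrite -natr_prod -natrX -natrM ler_nat.
have -> : (\prod_(t < k) (u + t.+1) = (u + k) ^_ k)%N.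
  rewrite ffact_prod (reindex_inj rev_ord_inj) /=.
  by apply: eq_bigr => i _; have := ltn_ord i; lia.
by rewrite -bin_ffact mulnC leq_mul2l bin_le_exp2 orbT.
Qed.

Lemma weight_zeros_le n L (x : rat) (u : nat) : (pade_deg n <= L)%N ->
  (forall j t, `|x - ((L + t.+1)%:R + lambda j)| <= (u + t.+1)%:R) ->
  `|weight n * (pade_zeros lambda n L).[x]| <= S%:R ^+ (2 * L) * 2 ^+ (m * u + L).
Proof.
move=> nL H; rewrite /weight /pade_zeros horner_prod -big_split /= normr_prod.
apply: (@le_trans _ _ (\prod_j (S%:R ^+ (2 * n j) * 2 ^+ (u + n j)))).
  apply: ler_prod => j _; rewrite normr_ge0 /= !normrM normfV normrX normr_nat.
  have f0 : (0 : rat) < (n j)`!%:R by rewrite ltr0n fact_gt0.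
  rewrite -mulrA ler_pM ?exprn_ge0 //.
    by rewrite lerXn2r ?nnegrE // -intr_norm -abszE ler_nat.
  rewrite mulrC ler_pdivrMr // mulrC horner_prod normr_prod.
  under eq_bigr do rewrite hornerXsubC.
  exact: (@prod_le_fact_exp2 _ u (fun t => x - ((L + t.+1)%:R + lambda j))) (H j).
rewrite big_split !prodrXr [(\sum_(i < m) (u + n i))%N]big_split sum_nat_const card_ord -big_distrr.
rewrite ler_pM ?exprn_ge0 //.
  by rewrite ler_weXn2l ?ler1n // leq_mul2l.
by rewrite ler_weXn2l ?ler1n // leq_add2l.
Qed.

Lemma newton_coef_le n L k : (pade_deg n <= L)%N -> (k <= L)%N ->
  `|weight n * newton_coef lambda n L k| <=
    2 ^+ k / k`!%:R * (S%:R ^+ (2 * L) * 2 ^+ (m * (L + rho) + L)).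
Proof.
move=> nL kL; rewrite /newton_coef mulrA -fdiffZ normrM normfV normr_nat.
rewrite [leRHS]mulrAC ler_wpM2r ?invr_ge0 //.
apply: fdiff_le => i; rewrite add0n => ik; apply: weight_zeros_le => // j t.
rewrite opprD addrA; apply: le_trans (ler_normB _ _) _.
rewrite addnAC [(_ + rho)%:R]natrD lerD ?lambda_le // distrC ger0_norm.
  by rewrite lerBlDr lerDl.
by rewrite subr_ge0 ler_nat; lia.
Qed.

Lemma add_lambda_neq0 j t : t.+1%:R + lambda j != 0.
Proof. by have := nz j t.+1; rewrite /bracket big_nat_recr //= mulf_eq0 negb_or => /andP[_ ]. Qed.

Lemma add_lambda_ge j t : 1 <= S%:R * `|t.+1%:R + lambda j|.
Proof.
set d := (denq (lambda j))%:~R : rat.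
have dS : `|d| <= S%:R by rewrite -intr_norm -abszE ler_nat.
apply: le_trans (_ : `|d| * `|t.+1%:R + lambda j| <= _); last by rewrite ler_wpM2r.
rewrite -normrM.
have E : d * (t.+1%:R + lambda j) = (denq (lambda j) * t.+1%:Z + numq (lambda j))%:~R.
  by rewrite mulrDr [d * lambda j]mulrC -numqE intrD intrM.
have : d * (t.+1%:R + lambda j) != 0.
  by rewrite mulf_neq0 ?add_lambda_neq0 // intr_eq0 denq_neq0.
rewrite E intr_eq0 -intr_norm -[1]/(1%:~R) ler_int; lia.
Qed.

(** A factor t + lambda is at least 1/S in modulus, and at least t - rho once
    t > rho; passing from (l-rho)! to l! costs rho! and a binomial coefficient. *)
Lemma bracket_ge j l :
  l`!%:R <= 2 ^+ l * (rho`!%:R * S%:R ^+ rho) * `|bracket (lambda j) l|.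
Proof.
have S0 : (0 : rat) < S%:R by rewrite ltr0n.
have H : (l - rho)`!%:R <= S%:R ^+ (minn l rho) * `|bracket (lambda j) l|.
  elim: l => [|l IH]; first by rewrite min0n /bracket big_nil normr1.
  rewrite /bracket big_nat_recr //= -/(bracket (lambda j) l) normrM.
  have [ll|ll] := ltnP l rho.
    have -> : (l.+1 - rho = l - rho)%N by lia.
    have -> : minn l.+1 rho = (minn l rho).+1 by lia.
    rewrite exprSr mulrACA -[leLHS]mulr1 ler_pM ?add_lambda_ge //.
  have -> : (l.+1 - rho = (l - rho).+1)%N by lia.
  have -> : minn l.+1 rho = minn l rho by lia.
  rewrite factS mulnC natrM mulrA ler_pM //.
  rewrite (_ : (l - rho).+1%:R = l.+1%:R - rho%:R :> rat); last by rewrite -natrB ?subSn // ltnW.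
  have := lambda_le j; rewrite ler_norml => /andP[h _].
  by apply: le_trans (ler_norm _); rewrite lerD2l.
have H2 : (l`! <= 2 ^ l * rho`! * (l - rho)`!)%N.
  have [lr|lr] := leqP rho l.
    by rewrite -(bin_fact lr) mulnA leq_mul // leq_mul // bin_le_exp2.
  rewrite (eqP (_ : l - rho == 0)%N) ?fact0 ?muln1; last by rewrite subn_eq0 ltnW.
  by apply: leq_trans (leq_fact (ltnW lr)) _; rewrite leq_pmull ?expn_gt0.
apply: (@le_trans _ _ (2 ^+ l * rho`!%:R * (l - rho)`!%:R)).
  by rewrite -natrX -!natrM ler_nat.
rewrite mulrA -[leRHS]mulrA ler_wpM2l ?mulr_ge0 ?exprn_ge0 //.
apply: le_trans H _; rewrite ler_wpM2r // ler_weXn2l ?ler1n //; lia.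
Qed.

Lemma prod_coef_le n L j l : (pade_deg n <= L)%N -> (L <= l)%N ->
  `|weight n * prod_coef lambda n L (lambda j) l| <=
  2 ^+ l / l`!%:R * (rho`!%:R * S%:R ^+ rho) *
   (S%:R ^+ (2 * L) * 2 ^+ (m * (l - L + 2 * rho) + L)).
Proof.
move=> nL Ll; rewrite prod_coef_ge //; last exact: leq_trans Ll.
rewrite [weight n * _]mulrA normrM normfV mulrC.
have b0 : 0 < `|bracket (lambda j) l| by rewrite normr_gt0.
apply: ler_pM; rewrite ?invr_ge0 //.
  have f0 : (0 : rat) < l`!%:R by rewrite ltr0n fact_gt0.
  rewrite -[leLHS]mul1r ler_pdivrMr // mulrAC mulrAC -mulrA.
  rewrite [leRHS](_ : _ = (2 ^+ l * (rho`!%:R * S%:R ^+ rho) * `|bracket (lambda j) l|) / l`!%:R).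
    by rewrite ler_pdivlMr // mul1r; apply: bracket_ge.
  by ring.
apply: weight_zeros_le => // i t.
have -> : l%:R + lambda j - ((L + t.+1)%:R + lambda i) =
  ((l - L)%:R - t.+1%:R) + (lambda j - lambda i).
  by rewrite natrD natrB //; ring.
apply: le_trans (ler_normD _ _) _.
have H1 : `|lambda j - lambda i| <= (2 * rho)%:R.
  by rewrite mul2n -addnn natrD; apply: le_trans (ler_normB _ _) _; rewrite lerD ?lambda_le.
have H2 : `|(l - L)%:R - t.+1%:R| <= (l - L)%:R + t.+1%:R :> rat.
  by apply: le_trans (ler_normB _ _) _; rewrite !normr_nat.
by apply: le_trans (lerD H2 H1) _; rewrite -!natrD ler_nat; lia.
Qed.

End Arith.

(** * The complex modulus *)

Section Cmod.
Variable R : realType.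
Implicit Types z w : R[i].
Local Open Scope complex_scope.

Lemma cmodE z : `|z| = (cmod z)%:C.
Proof. by []. Qed.

Lemma cmod_ge0 z : 0 <= cmod z.
Proof. by rewrite -lecR -cmodE normr_ge0. Qed.

Lemma cmod0 : cmod (0 : R[i]) = 0.
Proof. by apply: complexI; rewrite -cmodE normr0. Qed.

Lemma cmod_eq0 z : (cmod z == 0) = (z == 0).
Proof. by rewrite -(inj_eq (@complexI R)) -cmodE normr_eq0. Qed.

Lemma cmodN z : cmod (- z) = cmod z.
Proof. by apply: complexI; rewrite -!cmodE normrN. Qed.

Lemma cmodM z w : cmod (z * w) = cmod z * cmod w.
Proof. exact: Normc.normcM. Qed.

Lemma cmodV z : cmod z^-1 = (cmod z)^-1.
Proof. exact: Normc.normcV. Qed.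

Lemma cmodX z n : cmod (z ^+ n) = cmod z ^+ n.
Proof. by apply: complexI; rewrite rmorphXn /= -!cmodE normrX. Qed.

Lemma cmodD z w : cmod (z + w) <= cmod z + cmod w.
Proof. by rewrite -lecR rmorphD /= -!cmodE ler_normD. Qed.

Lemma cmod_sum I (r : seq I) (P : pred I) (F : I -> R[i]) :
  cmod (\sum_(i <- r | P i) F i) <= \sum_(i <- r | P i) cmod (F i).
Proof.
elim/big_ind2: _ => [|x1 x2 y1 y2 h1 h2|//]; first by rewrite cmod0.
by apply: le_trans (cmodD _ _) _; apply: lerD.
Qed.

Lemma cmodR (x : R) : cmod x%:C = `|x|.
Proof. by rewrite /cmod /Normc.normc /= expr0n addr0 sqrtr_sqr. Qed.

Lemma ratr_complex (q : rat) : ratr q = (ratr q)%:C :> R[i].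
Proof. by rewrite -(fmorph_rat (real_complex R)). Qed.

Lemma cmod_ratr (q : rat) : cmod (ratr q : R[i]) = ratr `|q|.
Proof. by rewrite ratr_complex cmodR ratr_norm. Qed.

Lemma cmod_ge_Re z : `|complex.Re z| <= cmod z.
Proof.
case: z => a b; rewrite /cmod /Normc.normc /= -sqrtr_sqr ler_sqrt.
  by rewrite lerDl sqr_ge0.
by rewrite addr_ge0 ?sqr_ge0.
Qed.

Lemma cmod_ge_Im z : `|complex.Im z| <= cmod z.
Proof.
case: z => a b; rewrite /cmod /Normc.normc /= -sqrtr_sqr ler_sqrt.
  by rewrite lerDr sqr_ge0.
by rewrite addr_ge0 ?sqr_ge0.
Qed.

Lemma cmod_le_Re_Im (a b : R) : cmod (a +i* b) <= `|a| + `|b|.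
Proof.
rewrite /cmod /Normc.normc -[leRHS]ger0_norm ?addr_ge0 // -sqrtr_sqr ler_sqrt ?sqr_ge0 //.
rewrite -(real_normK (num_real a)) -(real_normK (num_real b)).
by rewrite sqrrD lerD2r lerDl mulrn_wge0 ?mulr_ge0.
Qed.

End Cmod.

(** * Convergence of series of exponential type *)

Section Converge.
Variable R : realType.
Local Open Scope complex_scope.
Local Open Scope classical_set_scope.

Lemma exp_partial_le (x : R) n : 0 <= x -> \sum_(0 <= k < n) x ^+ k / k`!%:R <= expR x.
Proof.
move=> x0; apply: (nondecreasing_cvgn_le (u_ := series (exp_coeff x))).
  apply/nondecreasing_seqP => k; rewrite /series /= big_nat_recr //= lerDl.
  exact: exp_coeff_ge0.
exact: is_cvg_series_exp_coeff.
Qed.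

Lemma real_series_cvg (u : nat -> R) (M x : R) : 0 <= M -> 0 <= x ->
  (forall k, `|u k| <= M * (x ^+ k / k`!%:R)) -> cvgn (series u).
Proof.
move=> M0 x0 H; apply: normed_cvg.
apply: (series_le_cvg (v_ := M *: exp_coeff x)) => //.
- by move=> n; exact: normr_ge0.
- by move=> n; apply: (mulr_ge0 M0 (exp_coeff_ge0 _ x0)).
- by apply: is_cvg_seriesZ; apply: is_cvg_series_exp_coeff.
Qed.

(** Completeness is used only for the real and imaginary parts, whose series
    converge absolutely. *)
Lemma complex_series_lim (u : nat -> R[i]^o) (M x : R) : 0 <= M -> 0 <= x ->
  (forall k, cmod (u k) <= M * (x ^+ k / k`!%:R)) ->
  forall e, 0 < e -> exists N0, forall N, (N0 <= N)%N ->
  cmod (limn (series u) - \sum_(0 <= k < N) u k) <= e.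
Proof.
move=> M0 x0 H.
have cRe : cvgn (series (fun k => complex.Re (u k))).
  by apply: (real_series_cvg M0 x0) => k; apply: le_trans (cmod_ge_Re _) (H k).
have cIm : cvgn (series (fun k => complex.Im (u k))).
  by apply: (real_series_cvg M0 x0) => k; apply: le_trans (cmod_ge_Im _) (H k).
set a := limn _ in cRe *; set b := limn _ in cIm *.
have sE N : \sum_(0 <= k < N) u k =
  (\sum_(0 <= k < N) complex.Re (u k)) +i* (\sum_(0 <= k < N) complex.Im (u k)).
  elim: N => [|N IH]; first by rewrite !big_nil.
  by rewrite !big_nat_recr //= IH; case: (u N) => c d.
have main e : 0 < e -> exists N0, forall N, (N0 <= N)%N ->
   cmod (a +i* b - \sum_(0 <= k < N) u k) < e.
  move=> e0; have e20 : 0 < e / 2 by rewrite divr_gt0.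
  have /cvgrPdist_lt /(_ _ e20) [N1 _ H1] := cRe.
  have /cvgrPdist_lt /(_ _ e20) [N2 _ H2] := cIm.
  exists (maxn N1 N2) => N; rewrite geq_max => /andP[n1 n2].
  rewrite sE; apply: le_lt_trans (cmod_le_Re_Im _ _) _.
  rewrite [e]splitr ltrD //.
    by apply: H1.
  by apply: H2.
have lim : series u @ \oo --> (a +i* b : R[i]^o).
  apply/cvgrPdist_lt => eps eps0.
  have [e eE] : exists e, eps = e%:C.
    by apply/complex_realP; rewrite realE ltW.
  have e0 : 0 < e by move: eps0; rewrite eE ltcR.
  have [N0 HN] := main e e0.
  by exists N0 => // N /= /HN; rewrite eE cmodE ltcR.
rewrite (cvg_lim _ lim) // => e e0.
by have [N0 HN] := main e e0; exists N0 => N /HN /ltW.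
Qed.

End Converge.

(** * Evaluation at a complex point *)

(** Pairing b_k with the partial sum of length M - k turns the product into an
    exact truncation, without boundary terms. *)
Lemma cauchy_partial (F : fieldType) (b f : nat -> F) (x : F) (N M : nat) :
  \sum_(k < N.+1) b k * x ^+ k * (\sum_(0 <= nu < M - k) x ^+ nu * f nu) =
  \sum_(0 <= l < M) (\sum_(k < N.+1 | (k <= l)%N) b k * f (l - k)%N) * x ^+ l.
Proof.
under [RHS]eq_bigr do rewrite mulr_suml big_mkcond.
rewrite exchange_big /=; apply: eq_bigr => k _.
rewrite -big_mkcond /= [RHS](_ : _ = \sum_(k <= l < M) b k * f (l - k)%N * x ^+ l); last first.
  by rewrite [RHS](big_nat_widenl _ 0).
rewrite -[X in \sum_(X <= l < M) _]add0n big_addn mulr_sumr.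
by apply: eq_bigr => nu _; rewrite addnK exprD; ring.
Qed.

Section Eval.
Variables (R : realType).
Local Open Scope complex_scope.

(** By cauchy_partial the difference is, at every finite stage M, a partial sum
    of the tail up to an error that tends to 0 with M. *)
Lemma phi_approx_rem (mu : rat) (x : R[i]) (N L : nat) (b c : nat -> rat) (B : R) :
  (forall e, 0 < e -> exists N0, forall M, (N0 <= M)%N ->
    cmod (phi mu x - \sum_(0 <= nu < M) x ^+ nu / ratr (bracket mu nu)) <= e) ->
  (forall l, c l = \sum_(k < N.+1 | (k <= l)%N) b k / bracket mu (l - k)) ->
  (forall M, cmod (\sum_(L.+1 <= l < M) ratr (c l) * x ^+ l) <= B) ->
  cmod ((\sum_(k < N.+1) ratr (b k) * x ^+ k) * phi mu x
        - \sum_(l < L.+1) ratr (c l) * x ^+ l) <= B.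
Proof.
move=> Hphi cE HB; apply/ler_addgt0Pl => e e0.
pose K : R := \sum_(k < N.+1) cmod (ratr (b k) * x ^+ k).
have K0 : 0 <= K by apply: sumr_ge0 => k _; apply: cmod_ge0.
have e'0 : 0 < e / (K + 1) by rewrite divr_gt0 // ltr_wpDl.
have [N0 HN] := Hphi _ e'0.
(* Every index M - k with k <= N is then at least N0. *)
pose M := (N0 + N + L.+1)%N.
have Ec : \sum_(k < N.+1) ratr (b k) * x ^+ k *
    (\sum_(0 <= nu < M - k) x ^+ nu / ratr (bracket mu nu)) =
  \sum_(l < L.+1) ratr (c l) * x ^+ l + \sum_(L.+1 <= l < M) ratr (c l) * x ^+ l.
  rewrite (cauchy_partial (fun k => ratr (b k)) (fun nu => (ratr (bracket mu nu))^-1)).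
  rewrite -(big_mkord xpredT (fun l => ratr (c l) * x ^+ l)) -big_cat_nat //=; last first.
    by rewrite /M leq_addl.
  apply: eq_bigr => l _; congr (_ * _); rewrite cE rmorph_sum /=.
  by apply: eq_bigr => k _; rewrite rmorphM fmorphV.
have -> : (\sum_(k < N.+1) ratr (b k) * x ^+ k) * phi mu x
        - \sum_(l < L.+1) ratr (c l) * x ^+ l =
  \sum_(k < N.+1) ratr (b k) * x ^+ k *
    (phi mu x - \sum_(0 <= nu < M - k) x ^+ nu / ratr (bracket mu nu)) +
  \sum_(L.+1 <= l < M) ratr (c l) * x ^+ l.
  under [in RHS]eq_bigr do rewrite mulrBr.
  by rewrite sumrB Ec mulr_suml; ring.
apply: le_trans (cmodD _ _) _; apply: lerD (HB M).
apply: le_trans (cmod_sum _ _ _) _.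
apply: (@le_trans _ _ (K * (e / (K + 1)))).
  rewrite /K mulr_suml; apply: ler_sum => k _; rewrite cmodM ler_wpM2l ?cmod_ge0 //.
  by apply: HN; have := ltn_ord k; rewrite /M; lia.
rewrite mulrCA ler_piMr //; first exact: ltW.
by rewrite ler_pdivrMr ?mul1r ?lerDl // ltr_wpDl.
Qed.

Definition int_poly (p : {poly rat}) : {poly int} := map_poly numq p.

Lemma int_poly_horner (p : {poly rat}) (x : R[i]) : (forall k, p`_k \is a Num.int) ->
  (map_poly intr (int_poly p)).[x] = (map_poly ratr p).[x].
Proof.
move=> H; congr (_.[x]); apply/polyP => k.
by rewrite coef_map_id0 // coef_map_id0 // coef_map /= -[p`_k in RHS](numqK (H k)) ratr_int.
Qed.

Lemma size_int_poly (p : {poly rat}) k : (size p <= k)%N -> (size (int_poly p) <= k)%N.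
Proof. by move=> H; apply: leq_trans (size_poly _ _) H. Qed.

Lemma horner_scaled_poly (g : rat) (n : nat) (f : nat -> rat) (x : R[i]) :
  (map_poly ratr (g *: \poly_(k < n) f k)).[x] = \sum_(k < n) ratr (g * f k) * x ^+ k.
Proof.
rewrite poly_def scaler_sumr rmorph_sum /= horner_sum; apply: eq_bigr => k _.
by rewrite scalerA map_polyZ map_polyXn /= hornerZ hornerXn.
Qed.

End Eval.

(** * Pade approximations with integer coefficients *)

Section System.
Variables (R : realType) (m : nat) (lambda : 'I_m -> rat) (S rho : nat) (x : R[i]).
Hypothesis nz : forall j nu, bracket (lambda j) nu != 0.
Hypothesis S_ge1 : (1 <= S)%N.
Hypothesis den_le : forall j, (`|denq (lambda j)| <= S)%N.
Hypothesis num_le : forall j, (`|numq (lambda j)| <= rho)%N.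
Local Open Scope complex_scope.

Let E : R := rho`!%:R * S%:R ^+ rho.

Lemma phi_cvg j e : 0 < e -> exists N0, forall M, (N0 <= M)%N ->
  cmod (phi (lambda j) x - \sum_(0 <= nu < M) x ^+ nu / ratr (bracket (lambda j) nu)) <= e.
Proof.
apply: (@complex_series_lim R _ E (2 * cmod x)).
- by rewrite mulr_ge0 ?exprn_ge0.
- by rewrite mulr_ge0 ?cmod_ge0.
move=> k; rewrite cmodM cmodV cmodX cmod_ratr.
have b0 : 0 < ratr `|bracket (lambda j) k| :> R by rewrite ltr0q normr_gt0.
rewrite ler_pdivrMr // exprMn.
have := bracket_ge nz S_ge1 den_le num_le j k.
rewrite -(ler_rat R) !(rmorphM, rmorphXn, rmorph_nat) /= => H.
have f0 : (0 : R) < k`!%:R by rewrite ltr0n fact_gt0.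
rewrite [leRHS](_ : _ = cmod x ^+ k * ((2 ^+ k * (rho`!%:R * S%:R ^+ rho)
   * ratr `|bracket (lambda j) k|) / k`!%:R)); last by rewrite /E; ring.
by rewrite -[leLHS]mulr1 ler_wpM2l ?exprn_ge0 ?cmod_ge0 // ler_pdivlMr // mul1r.
Qed.

Section Fixed.
Variables (n : 'I_m -> nat) (L : nat).
Hypothesis sum_n : (pade_deg n <= L)%N.

Definition common_lcm : nat := lcm_upto (S * L + rho).

Definition pade_scale : rat := common_lcm%:R * L`!%:R * weight lambda n.

Lemma dvdn_common_lcm j t : (1 <= t <= L)%N ->
  (absz (numq (lambda j) + denq (lambda j) * t%:Z)%R %| common_lcm)%N.
Proof.
move=> /andP[t1 tL]; apply: dvdn_lcm_upto; apply/andP; split.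
  case: t t1 {tL} => // t _.
  have d0 : ((denq (lambda j))%:~R : rat) != 0 by rewrite intr_eq0 denq_neq0.
  rewrite absz_gt0 -(intr_eq0 rat) intrD intrM numqE mulrC -mulrDr mulf_neq0 //.
  by rewrite addrC; apply: add_lambda_neq0.
have H : (absz (denq (lambda j) * t%:Z)%R <= S * L)%N by rewrite abszM leq_mul.
have := num_le j; move: H; lia.
Qed.

Lemma pade_scale_neq0 : pade_scale != 0.
Proof.
rewrite /pade_scale !mulf_neq0 ?pnatr_eq0 -?lt0n ?lcm_upto_gt0 ?fact_gt0 //.
rewrite prodf_seq_neq0; apply/allP => j _; apply/implyP => _.
by rewrite mulf_neq0 ?expf_neq0 ?intr_eq0 ?denq_neq0 ?invr_eq0 ?pnatr_eq0 -?lt0n ?fact_gt0.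
Qed.

Lemma pade_den_scaled_int k : (pade_scale *: pade_den lambda n L)`_k \is a Num.int.
Proof.
rewrite coefZ coef_poly; case: ifP => [kN|_]; last by rewrite mulr0.
rewrite /pade_scale -!mulrA; apply: rpredM; first exact: natr_int.
by rewrite mulrA; apply: pade_den_coef_int; apply: leq_trans sum_n.
Qed.

Lemma pade_num_scaled_int j k : (pade_scale *: pade_num lambda n L (lambda j))`_k \is a Num.int.
Proof.
rewrite coefZ coef_poly; case: ifP => [kN|_]; last by rewrite mulr0.
by apply: prod_coef_int => // t; apply: dvdn_common_lcm.
Qed.

Let den_val : R[i] := (map_poly ratr (pade_scale *: pade_den lambda n L)).[x].
Let num_val j : R[i] := (map_poly ratr (pade_scale *: pade_num lambda n L (lambda j))).[x].

Let mu : R := Num.max 1 (cmod x).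

(** The exponential rate in L: 16^S comes from the least common multiple, S^2 from
    the weight, the power of 2 from binomial coefficients, and the square of
    max(1, |x|) from indices l up to 2L. *)
Definition growth : R := 16 ^+ S * S%:R ^+ 2 * 2 ^+ (m + 3) * Num.max 1 (cmod x) ^+ 2.

Definition pade_const : R :=
  16 ^+ rho * 2 ^+ (2 * m * rho) * (1 + E) * expR (2 ^+ m.+1 * cmod x).

Lemma common_lcm_le : common_lcm%:R <= 16 ^+ rho * (16 ^+ S) ^+ L :> R.
Proof.
by rewrite -exprM -exprD -natrX ler_nat addnC; apply: lcm_upto_le.
Qed.

Let mu_ge1 : 1 <= mu. Proof. by rewrite /mu le_max lexx. Qed.

Let E_ge0 : 0 <= E. Proof. by rewrite mulr_ge0 ?exprn_ge0. Qed.

Lemma pade_den_val_le : cmod den_val <= pade_const * L`!%:R * growth ^+ L.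
Proof.
rewrite /den_val /pade_den horner_scaled_poly.
apply: le_trans (cmod_sum _ _ _) _.
pose Z : R := common_lcm%:R * L`!%:R * (S%:R ^+ (2 * L) * 2 ^+ (m * (L + rho) + L)).
have Z0 : 0 <= Z by rewrite !mulr_ge0 ?exprn_ge0.
have step k : (k <= L)%N -> cmod (ratr (pade_scale * newton_coef lambda n L k) * x ^+ k) <=
   Z * ((2 * cmod x) ^+ k / k`!%:R).
  move=> kL; rewrite cmodM cmodX cmod_ratr.
  have := newton_coef_le S_ge1 den_le num_le sum_n kL.
  rewrite -(ler_rat R) !(rmorphM, rmorphXn, rmorph_nat, fmorphV) /= => H.
  rewrite /pade_scale -[_ * _ * _ * _]mulrA normrM rmorphM /= ger0_norm ?mulr_ge0 //.
  rewrite rmorphM !rmorph_nat /= exprMn.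
  apply: le_trans (ler_wpM2r _ (ler_wpM2l _ H)) _; rewrite ?exprn_ge0 ?cmod_ge0 ?mulr_ge0 //.
  by rewrite le_eqVlt /Z; apply/orP; left; apply/eqP; ring.
apply: (@le_trans _ _ (Z * expR (2 * cmod x))).
  apply: (@le_trans _ _ (Z * \sum_(k < (pade_deg n).+1) (2 * cmod x) ^+ k / k`!%:R)).
    rewrite mulr_sumr; apply: ler_sum => k _; apply: step.
    by apply: leq_trans sum_n; rewrite -ltnS.
  rewrite ler_wpM2l // -(big_mkord xpredT (fun k => (2 * cmod x) ^+ k / k`!%:R)).
  by apply: exp_partial_le; rewrite mulr_ge0 ?cmod_ge0.
rewrite /pade_const.
apply: (@le_trans _ _ (16 ^+ rho * (16 ^+ S) ^+ L * L`!%:R *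
   (S%:R ^+ (2 * L) * 2 ^+ (m * (L + rho) + L)) * expR (2 ^+ m.+1 * cmod x))).
  rewrite ler_pM ?expR_ge0 //.
    by rewrite !ler_wpM2r ?mulr_ge0 ?exprn_ge0 // common_lcm_le.
  rewrite ler_expR ler_wpM2r ?cmod_ge0 // exprS ler_peMr // exprn_ege1 //.
  by rewrite ler1n.
rewrite /growth -/mu.
rewrite [leRHS](_ : _ = 16 ^+ rho * (16 ^+ S) ^+ L * L`!%:R *
   (S%:R ^+ (2 * L) * (2 ^+ (2 * m * rho) * (1 + E) * (2 ^+ ((m + 3) * L) * mu ^+ (2 * L)))) *
    expR (2 ^+ m.+1 * cmod x)); last first.
  rewrite !exprMn -!exprM (mul2n L) -addnn !exprD.
  move: (16 ^+ rho : R) (16 ^+ (S * L) : R) (2 ^+ (2 * m * rho) : R).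
  move: (2 ^+ ((m + 3) * L) : R) (S%:R ^+ L : R) (mu ^+ L) (expR _) => *.
  ring.
rewrite ler_wpM2r ?expR_ge0 // ler_wpM2l ?mulr_ge0 ?exprn_ge0 // ler_wpM2l ?exprn_ge0 //.
apply: (@le_trans _ _ (2 ^+ (2 * m * rho + (m + 3) * L))).
  by rewrite ler_weXn2l ?ler1n //; nia.
rewrite exprD [leRHS]mulrACA ler_peMr ?mulr_ge0 ?exprn_ge0 //.
by rewrite mulr_ege1 ?exprn_ege1 // lerDl.
Qed.

Lemma fact_mul3_le a b c : (a`! * b`! * c`! <= (a + b + c)`!)%N.
Proof.
have H p q : (p`! * q`! <= (p + q)`!)%N.
  rewrite -(bin_fact (leq_addr q p)) addKn leq_pmull // bin_gt0 leq_addr //.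
by apply: leq_trans (H _ _); rewrite leq_mul2r H orbT.
Qed.

Let rem_coef j l : rat := pade_scale * prod_coef lambda n L (lambda j) l.

Lemma rem_coef0 j l : (L < l < L + (n j).+1)%N -> rem_coef j l = 0.
Proof.
move=> /andP[Ll ll]; rewrite /rem_coef prod_coef_ge //; last exact: leq_trans (ltnW Ll).
have -> : l = (L + (l - L.+1).+1)%N by lia.
by rewrite pade_zeros_root ?mul0r ?mulr0 //; lia.
Qed.

(** The inequality L! n_j! w! <= (L + n_j + w)! produces the decisive factor
    1 / n_j! and leaves an exponential series in w. *)
Lemma rem_coef_le j w (l := (L + n j + w)%N) : cmod (ratr (rem_coef j l) * x ^+ l) <=
  16 ^+ rho * (16 ^+ S) ^+ L * (S%:R ^+ (2 * L) * 2 ^+ (2 * m * rho) * E) *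
   (2 ^+ ((m + 3) * L) * mu ^+ (2 * L)) / (n j)`!%:R *
   ((2 ^+ m.+1 * cmod x) ^+ w / w`!%:R).
Proof.
have Ll : (L <= l)%N by rewrite /l -addnA leq_addr.
rewrite cmodM cmodX cmod_ratr.
have := prod_coef_le nz S_ge1 den_le num_le j sum_n Ll.
rewrite -(ler_rat R) !(rmorphM, rmorphXn, rmorph_nat, fmorphV) /= => H.
rewrite /rem_coef /pade_scale -[_ * _ * _ * _]mulrA normrM rmorphM /= ger0_norm ?mulr_ge0 //.
rewrite rmorphM !rmorph_nat /=.
apply: le_trans (ler_wpM2r _ (ler_wpM2l _ H)) _; rewrite ?exprn_ge0 ?cmod_ge0 ?mulr_ge0 //.
have x0 := cmod_ge0 x.
have f0 k : (0 : R) < k`!%:R by rewrite ltr0n fact_gt0.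
have H1 : L`!%:R / l`!%:R <= 1 / ((n j)`!%:R * w`!%:R) :> R.
  rewrite ler_pdivrMr // mulrAC ler_pdivlMr ?mulr_gt0 // mul1r -!natrM ler_nat mulnA.
  exact: fact_mul3_le.
have nL := pade_deg_ge j sum_n.
have H2 : 2 ^+ l * 2 ^+ (m * (l - L + 2 * rho) + L) <=
    2 ^+ (2 * m * rho) * 2 ^+ ((m + 3) * L) * 2 ^+ (m.+1 * w) :> R.
  by rewrite -!exprD ler_weXn2l ?ler1n // /l; nia.
have H3 : cmod x ^+ l <= mu ^+ (2 * L) * cmod x ^+ w.
  rewrite /l exprD ler_wpM2r ?exprn_ge0 //; apply: (@le_trans _ _ (mu ^+ (L + n j))).
    have xmu : cmod x <= mu by rewrite /mu le_max lexx orbT.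
    by rewrite lerXn2r ?nnegrE // (le_trans x0 xmu).
  by rewrite ler_weXn2l //; lia.
have H4 := common_lcm_le.
rewrite [leLHS](_ : _ = (common_lcm%:R * (L`!%:R / l`!%:R)) *
   ((2 ^+ l * 2 ^+ (m * (l - L + 2 * rho) + L)) * (S%:R ^+ (2 * L) * E * cmod x ^+ l))); last first.
  by rewrite /E; move: (2 ^+ (m * _ + L) : R) (2 ^+ l : R) (S%:R ^+ (2 * L) : R)
    (cmod x ^+ l) (S%:R ^+ rho : R) => *; ring.
apply: (@le_trans _ _ ((16 ^+ rho * (16 ^+ S) ^+ L * (1 / ((n j)`!%:R * w`!%:R))) *
  ((2 ^+ (2 * m * rho) * 2 ^+ ((m + 3) * L) * 2 ^+ (m.+1 * w)) *
   (S%:R ^+ (2 * L) * E * (mu ^+ (2 * L) * cmod x ^+ w))))).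
  have mu0 : 0 <= mu by apply: le_trans mu_ge1.
  have fd0 a b : 0 <= (a`!%:R / b`!%:R : R) by rewrite divr_ge0 // ltW.
  rewrite ler_pM ?mulr_ge0 ?exprn_ge0 //.
    by rewrite ler_pM.
  rewrite ler_pM ?mulr_ge0 ?exprn_ge0 //.
  by rewrite ler_wpM2l ?mulr_ge0 ?exprn_ge0.
rewrite le_eqVlt; apply/orP; left; apply/eqP; rewrite exprMn -[(2 ^+ m.+1) ^+ w]exprM.
move: (2 ^+ (m.+1 * w) : R) (2 ^+ (2 * m * rho) : R) (2 ^+ ((m + 3) * L) : R)
  (S%:R ^+ (2 * L) : R) (mu ^+ (2 * L)) (cmod x ^+ w) (16 ^+ rho : R) ((16 ^+ S) ^+ L : R) => *.
by field; rewrite !gt_eqF.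
Qed.

Lemma pade_rem_val_le j :
  cmod (den_val * phi (lambda j) x - num_val j) <= pade_const * growth ^+ L / (n j)`!%:R.
Proof.
rewrite /den_val /num_val /pade_den /pade_num !horner_scaled_poly.
apply: (phi_approx_rem (b := fun k => pade_scale * newton_coef lambda n L k)
  (c := rem_coef j) (@phi_cvg j)) => [l|M].
  by rewrite /rem_coef /prod_coef mulr_sumr; apply: eq_bigr => k _; rewrite mulrA.
apply: le_trans (cmod_sum _ _ _) _.
set F := fun l => cmod (ratr (rem_coef j l) * x ^+ l).
have shift : \sum_(L.+1 <= l < M) F l <= \sum_(0 <= w < M - (L + n j)) F (L + n j + w)%N.
  elim: M => [|M IH]; first by rewrite big_geq ?big_geq.
  have [ML|LM] := ltnP M L.+1.
    by rewrite big_geq // sumr_ge0 // => w _; apply: cmod_ge0.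
  rewrite big_nat_recr //=; have [MLn|LnM] := ltnP M (L + n j).
    rewrite (_ : (M.+1 - (L + n j) = 0)%N); last lia.
    rewrite [X in _ <= X]big_geq //; move: IH; rewrite (_ : (M - (L + n j) = 0)%N); last lia.
    rewrite [X in _ <= X]big_geq // => IH; rewrite {2}/F rem_coef0; last lia.
    by rewrite rmorph0 mul0r cmod0 addr0.
  by rewrite subSn // [X in _ <= X]big_nat_recr //= subnKC // lerD2r.
apply: le_trans shift _.
set Cst := 16 ^+ rho * (16 ^+ S) ^+ L * (S%:R ^+ (2 * L) * 2 ^+ (2 * m * rho) * E) *
   (2 ^+ ((m + 3) * L) * mu ^+ (2 * L)) / (n j)`!%:R : R.
have mu0 : 0 <= mu by apply: le_trans mu_ge1.
have f0 k : (0 : R) < k`!%:R by rewrite ltr0n fact_gt0.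
have C0 : 0 <= Cst by rewrite divr_ge0 ?(ltW (f0 _)) ?mulr_ge0 ?exprn_ge0.
apply: (@le_trans _ _ (Cst * expR (2 ^+ m.+1 * cmod x))).
  apply: (@le_trans _ _ (Cst * \sum_(0 <= w < M - (L + n j)) (2 ^+ m.+1 * cmod x) ^+ w / w`!%:R)).
    by rewrite mulr_sumr; apply: ler_sum => w _; apply: rem_coef_le.
  by rewrite ler_wpM2l // exp_partial_le // mulr_ge0 ?exprn_ge0 ?cmod_ge0.
rewrite /pade_const /growth -/mu.
rewrite [leRHS](_ : _ = 16 ^+ rho * (16 ^+ S) ^+ L * (S%:R ^+ (2 * L) * 2 ^+ (2 * m * rho) * (1 + E)) *
   (2 ^+ ((m + 3) * L) * mu ^+ (2 * L)) / (n j)`!%:R * expR (2 ^+ m.+1 * cmod x)); last first.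
  rewrite !exprMn -!exprM (mul2n L) -addnn !exprD.
  move: (16 ^+ rho : R) (16 ^+ (S * L) : R) (2 ^+ (2 * m * rho) : R).
  move: (2 ^+ ((m + 3) * L) : R) (S%:R ^+ L : R) (mu ^+ L) (expR _) => *.
  by field; rewrite gt_eqF.
rewrite /Cst ler_wpM2r ?expR_ge0 // ler_wpM2r ?invr_ge0 ?(ltW (f0 _)) //.
rewrite ler_wpM2r ?mulr_ge0 ?exprn_ge0 // ler_wpM2l ?mulr_ge0 ?exprn_ge0 //.
by rewrite ler_wpM2l ?mulr_ge0 ?exprn_ge0 // lerDr.
Qed.

End Fixed.

End System.

Lemma bracket_neq0 (mu : rat) nu : ~ (mu \is a Num.int /\ mu < 0) -> bracket mu nu != 0.
Proof.
move=> H; rewrite prodf_seq_neq0; apply/allP => k; rewrite mem_index_iota => /andP[k1 _].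
apply/implyP => _; apply/eqP => /eqP; rewrite addrC addr_eq0 => /eqP E; apply: H.
by rewrite E rpredN natr_int oppr_lt0 ltr0n.
Qed.

Definition value_mx (R : realType) (m : nat) (q : 'I_m.+1 -> {poly int})
    (p : 'I_m.+1 -> 'I_m -> {poly int}) (x : R[i]) : 'M[R[i]]_m.+1 :=
  \matrix_(i, j) if unlift ord0 j is Some j' then (map_poly intr (p i j')).[x]
                 else (map_poly intr (q i)).[x].

(** The approximations in the form in which they are used: the factor L in the
    last bound pays for the lowered entry of n. *)
Lemma pade_system (R : realType) (m : nat) (lambda : 'I_m -> rat) (S : nat) (x : R[i]) :
  (1 <= S)%N ->
  (forall j, (`|denq (lambda j)| <= S)%N) ->
  (forall j, ~ (lambda j \is a Num.int /\ lambda j < 0)) ->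
  (forall i j, i != j -> lambda i - lambda j \isn't a Num.int) ->
  x != 0 ->
  exists2 A : R, 0 < A & forall (L : nat) (n : 'I_m -> nat),
    (forall j, (0 < n j)%N) -> (\sum_j n j <= L)%N ->
    exists (q : 'I_m.+1 -> {poly int}) (p : 'I_m.+1 -> 'I_m -> {poly int}),
    [/\ forall i, (size (q i) <= L.+1)%N,
        forall i j, (size (p i j) <= L.+1)%N,
        \det (value_mx q p x) != 0,
        forall i, cmod (map_poly intr (q i)).[x] <= A * L`!%:R * growth m S x ^+ L &
        forall i j, cmod ((map_poly intr (q i)).[x] * phi (lambda j) x
           - (map_poly intr (p i j)).[x]) <= A * L%:R * growth m S x ^+ L / (n j)`!%:R].
Proof.
move=> S1 den_le Hl Hd x0.
pose rho := (\sum_j `|numq (lambda j)|)%N.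
have num_le j : (`|numq (lambda j)| <= rho)%N by rewrite /rho (bigD1 j) //= leq_addr.
have nz j nu : bracket (lambda j) nu != 0 by apply: bracket_neq0.
exists (pade_const m S rho x).
  have E0 : 0 < 1 + rho`!%:R * S%:R ^+ rho :> R by rewrite ltr_wpDr // mulr_ge0 ?exprn_ge0.
  by rewrite /pade_const; do !apply: mulr_gt0; rewrite ?exprn_gt0 ?expR_gt0.
move=> L n n0 nL.
have nL' i : (pade_deg (shifted n i) <= L)%N by apply: leq_trans (shifted_le n i) nL.
pose g i := pade_scale lambda S rho (shifted n i) L.
pose q i := int_poly (g i *: pade_den lambda (shifted n i) L).
pose p i j := int_poly (g i *: pade_num lambda (shifted n i) L (lambda j)).
have qE i : (map_poly intr (q i)).[x] = (map_poly ratr (g i *: pade_den lambda (shifted n i) L)).[x].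
  by apply: int_poly_horner => k; apply: pade_den_scaled_int.
have pE i j : (map_poly intr (p i j)).[x] =
   (map_poly ratr (g i *: pade_num lambda (shifted n i) L (lambda j))).[x].
  by apply: int_poly_horner => k; apply: pade_num_scaled_int.
exists q, p; split.
- move=> i; apply: size_int_poly; apply: leq_trans (size_scale_leq _ _) _.
  by apply: leq_trans (size_poly _ _) _; rewrite ltnS.
- move=> i j; apply: size_int_poly; apply: leq_trans (size_scale_leq _ _) _.
  exact: size_poly.
- have [c [K c0 detE]] := det_pade_mx_monomial nz Hd n0 nL.
  have -> : value_mx q p x = diag_mx (\row_i ratr (g i)) *m
     map_mx (horner_eval x) (map_mx (map_poly ratr) (pade_mx lambda n L)).
    rewrite mul_diag_mx; apply/matrixP => i j; rewrite !mxE.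
    by case: unliftP => [j' _|_]; rewrite ?qE ?pE map_polyZ /horner_eval hornerZ.
  rewrite det_mulmx det_map_mx det_map_mx detE /= map_polyZ map_polyXn /horner_eval.
  rewrite hornerZ hornerXn; apply: mulf_neq0; last first.
    by apply: mulf_neq0; [rewrite fmorph_eq0 | rewrite expf_neq0].
  rewrite det_diag prodf_seq_neq0; apply/allP => i _; apply/implyP => _.
  by rewrite mxE fmorph_eq0; apply: pade_scale_neq0.
- by move=> i; rewrite qE; apply: pade_den_val_le.
move=> i j; rewrite qE pE; apply: le_trans (pade_rem_val_le _ _ _ _ _ _ _) _ => //.
have f0 k : (0 : R) < k`!%:R by rewrite ltr0n fact_gt0.
have key : ((n j)`! <= L * (shifted n i j)`!)%N.
  have njL : (n j <= L)%N by apply: leq_trans nL; rewrite (bigD1 j) //= leq_addr.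
  rewrite -{1}(prednK (n0 j)) factS (prednK (n0 j)) leq_mul // leq_fact //.
  by rewrite /shifted; case: eqP => _ /=; lia.
have growth0 : 0 <= growth m S x.
  by rewrite /growth !mulr_ge0 ?exprn_ge0 // le_max ler01.
have P0 : 0 <= pade_const m S rho x * growth m S x ^+ L.
  rewrite mulr_ge0 ?exprn_ge0 // /pade_const; do !apply: mulr_ge0;
    by rewrite ?exprn_ge0 ?expR_ge0 ?addr_ge0 ?mulr_ge0 ?exprn_ge0.
rewrite ler_pdivrMr // [leRHS](_ : _ = pade_const m S rho x * growth m S x ^+ L *
  ((L * (shifted n i j)`!)%:R / (n j)`!%:R)); last by rewrite natrM; ring.
by rewrite ler_peMr // ler_pdivlMr // mul1r ler_nat.
Qed.

(** * Integers of imaginary quadratic fields *)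

Lemma integralOver_inj (F K : fieldType) (f : {rmorphism F -> K}) (y : F) :
  integralOver (intr : int -> K) (f y) -> integralOver (intr : int -> F) y.
Proof.
case=> p pm pr; exists p => //; rewrite -(fmorph_root f) -map_poly_comp.
by rewrite (eq_map_poly (g := intr)) // => z /=; rewrite rmorph_int.
Qed.

Lemma integralOver_morph (F K : fieldType) (f : {rmorphism F -> K}) (y : F) :
  integralOver (intr : int -> F) y -> integralOver (intr : int -> K) (f y).
Proof.
case=> p pm pr; exists p => //; move: pr; rewrite -(fmorph_root f) -map_poly_comp.
by rewrite (eq_map_poly (g := intr)) // => z /=; rewrite rmorph_int.
Qed.

Lemma rat_integral_int (q : rat) : integralOver (intr : int -> rat) q -> q \is a Num.int.
Proof.
move=> /(integralOver_morph (ratr : {rmorphism rat -> algC})) [p pm pr].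
rewrite -Cint_rat; apply: Cint_rat_Aint; first exact: Crat_rat.
apply: root_monic_Aint pr _ _; first exact: monic_map.
by apply/polyOverP => i; rewrite coef_map /= intr_int.
Qed.

Section Quadratic.
Variables (R : realType) (L : fieldExtType rat) (iota : {rmorphism L -> R[i]}).
Hypothesis HL : rational_or_imaginary_quadratic iota.
Local Open Scope complex_scope.

(** If y is not rational, then 1 and y span L and y^2 = u y + v. The image z of y
    cannot be real, since otherwise the whole embedding would be; comparing with
    the conjugate equation gives z + conj z = u, so z conj z = -v. *)
Lemma mul_conj_rational (y : L) : exists r : rat, iota y * (iota y)^* = ratr r.
Proof.
have rat_case : y \in <[1]>%VS -> exists r : rat, iota y * (iota y)^* = ratr r.
  move=> /vlineP[k ->]; exists (k * k).
  by rewrite rmorphZ_num rmorph1 mulr1 fmorph_rat rmorphM.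
have [|yN1] := boolP (y \in <[1]>%VS); first exact: rat_case.
case: HL => [d1|[d2 [x xreal]]].
  case: (negP yN1); suff <- : fullv = <[1]>%VS :> {vspace L} by exact: memvf.
  apply/esym/eqP; rewrite eqEdim subvf dim_vline oner_neq0.
  by rewrite d1.
have full : (<[y]> + <[1]>)%VS = fullv :> {vspace L}.
  have := (basisEfree [:: y; 1] fullv); rewrite subvf /= d2 andbT.
  rewrite free_cons span_seq1 yN1 seq1_free oner_neq0 => B.
  by rewrite -(span_seq1 1) -span_cons; apply: span_basis; rewrite B.
have coords w : exists u v : rat, iota w = ratr u * iota y + ratr v.
  have : w \in (<[y]> + <[1]>)%VS by rewrite full memvf.
  move=> /memv_addP[_ /vlineP[u ->] [_ /vlineP[v ->] ->]].
  by exists u, v; rewrite rmorphD !rmorphZ_num rmorph1 mulr1.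
have [yreal|ynreal] := boolP (iota y \is Num.real).
  have [u [v E]] := coords x; case/negP: xreal.
  have rr q : (ratr q : R[i]) \is Num.real.
    by rewrite ratr_complex; apply/complex_realP; exists (ratr q).
  by rewrite E rpredD // rpredM.
have [u [v E]] := coords (y ^+ 2); exists (- v).
rewrite rmorphXn /= in E.
set z := iota y in E ynreal *; rewrite rmorphN /=.
have Ec : z^* ^+ 2 = ratr u * z^* + ratr v.
  by rewrite -rmorphXn E rmorphD rmorphM /= !fmorph_rat.
have nz : z - z^* != 0.
  by rewrite subr_eq0 eq_sym -CrealE.
have H : z + z^* = ratr u.
  apply: (mulfI nz); transitivity (z ^+ 2 - z^* ^+ 2); first by ring.
  by rewrite E Ec; ring.
by move: E; rewrite -H => E; apply/eqP; rewrite -addr_eq0; apply/eqP; rewrite -[RHS](subrr (z ^+ 2)) {1}E; ring.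
Qed.

(** The squared modulus is a positive rational algebraic integer. *)
Lemma integer_norm_ge1 (y : L) : algebraic_integer y -> y != 0 -> 1 <= cmod (iota y).
Proof.
move=> yint y0.
have [r rE] := mul_conj_rational y.
have zint : integralOver (intr : int -> R[i]) (iota y) by apply: integralOver_morph.
have zcint : integralOver (intr : int -> R[i]) (iota y)^*.
  exact: (integralOver_morph (Num.conj : {rmorphism R[i] -> R[i]})).
have : integralOver (intr : int -> R[i]) (ratr r) by rewrite -rE; apply: integral_mul.
move=> /(integralOver_inj (f := (ratr : {rmorphism rat -> R[i]}))) /rat_integral_int rint.
have sq : (cmod (iota y)) ^+ 2 = ratr r.
  apply: complexI; rewrite rmorphXn /= -cmodE normCK rE.
  by rewrite ratr_complex.
have r1 : 1 <= r.
  have r0 : 0 < r.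
    by rewrite -(ltr0q R) -sq exprn_gt0 // lt_neqAle eq_sym cmod_eq0 fmorph_eq0 y0 cmod_ge0.
  by move: r0; rewrite -(numqK rint) ltr0z ler1z; lia.
by rewrite -(ler_pXn2r (n := 2)) ?nnegrE ?cmod_ge0 // expr1n sq -[1](ratr_nat _ 1) ler_rat.
Qed.

End Quadratic.

(** In a monic integral equation of y with nonzero constant term c, c / y is,
    up to sign, a polynomial in y with integer coefficients. *)
Lemma integral_denominator (F : fieldType) (y : F) : y != 0 ->
  integralOver (intr : int -> F) y ->
  exists2 D : nat, (0 < D)%N & integralOver (intr : int -> F) (D%:R / y).
Proof.
move=> y0 yint; case: (yint) => p.
have [n] := ubnP (size p); elim: n p => // n IH p /ltnSE sp pm pr.
have E : map_poly (intr : int -> F) p = map_poly intr (drop_poly 1 p) * 'X + (p`_0)%:~R%:P.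
  rewrite -{1}[p](poly_take_drop 1) rmorphD rmorphM /= map_polyXn expr1 addrC; congr (_ + _).
  by rewrite (size1_polyC (size_take_poly 1 p)) map_polyC /= coef_take_poly.
have [p0|p0] := eqVneq p`_0 0.
  have pE : p = drop_poly 1 p * 'X.
    by rewrite -{1}[p](poly_take_drop 1) (size1_polyC (size_take_poly 1 p)) coef_take_poly p0 add0r expr1.
  have dm : drop_poly 1 p \is monic by move: pm; rewrite {1}pE monicMr // monicX.
  apply: (IH (drop_poly 1 p)) => //.
    rewrite size_drop_poly; apply: leq_trans sp.
    by have := monic_neq0 pm; rewrite -size_poly_gt0; lia.
  move: pr; rewrite E p0 addr0 rootM rootX; by rewrite (negPf y0) orbF.
exists (absz p`_0); first by rewrite absz_gt0.
have Hy : integralOver (intr : int -> F) ((p`_0)%:~R / y).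
  have -> : (p`_0)%:~R / y = - (map_poly intr (drop_poly 1 p)).[y].
    move: pr; rewrite rootE E !hornerE addr_eq0 => /eqP H.
    by apply: (mulIf y0); rewrite mulfVK // mulNr H opprK.
  apply: integral_opp; apply: integral_horner => //.
  apply/integral_poly => i; rewrite coef_map /=.
  exact: (integral_id (intr : {rmorphism int -> F})).
rewrite -[_%:R]/((absz p`_0 : int)%:~R) abszE; case: (lerP 0 p`_0) => h.
  by rewrite ger0_norm.
by rewrite ltr0_norm // intrN mulNr; apply: integral_opp.
Qed.

(** * Factorial inequalities *)

(** Lower the largest k_j, which is at least the m-th part of the sum, by one. *)
Lemma multinomial_le m (k : 'I_m -> nat) :
  ((\sum_j k j)`! <= m ^ (\sum_j k j) * \prod_j (k j)`!)%N.
Proof.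
have [K] := ubnP (\sum_j k j)%N; elim: K k => // K IH k /ltnSE kK.
have [k0|k0] := posnP (\sum_j k j)%N.
  by rewrite k0 expn0 mul1n prodn_gt0 // => j; rewrite fact_gt0.
have [j0 _] : exists j : 'I_m, true.
  case: m k {IH kK} k0 => [|m] k; first by rewrite big_ord0.
  by exists ord0.
pose j := [arg max_(i > j0) k i].
have jmax i : (k i <= k j)%N by rewrite /j; case: arg_maxnP => //= a _ /(_ i)->.
have Kle : (\sum_i k i <= m * k j)%N.
  have : (\sum_i k i <= \sum_(i < m) k j)%N by apply: leq_sum.
  by rewrite sum_nat_const card_ord.
have kj0 : (0 < k j)%N by move: Kle k0; case: (k j) => //; rewrite muln0; lia.
pose k' i := (k i - (i == j))%N.
have Ek : (\sum_i k i = (\sum_i k' i).+1)%N.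
  rewrite (bigD1 j) //= [in RHS](bigD1 j) //= /k' eqxx subn1.
  rewrite -addSn prednK //; congr (_ + _)%N; apply: eq_bigr => i /negPf->.
  by rewrite subn0.
have Pk : (\prod_i (k i)`! = k j * \prod_i (k' i)`!)%N.
  rewrite (bigD1 j) //= [in RHS](bigD1 j) //= /k' eqxx subn1.
  rewrite mulnA -{1}(prednK kj0) factS prednK //; congr (_ * _)%N.
  by apply: eq_bigr => i /negPf->; rewrite subn0.
rewrite Pk Ek factS expnS mulnAC mulnA -Ek.
have := IH k'; rewrite -ltnS -Ek => /(_ kK) H.
rewrite -mulnA [X in (_ <= X)%N]mulnC mulnCA [X in (_ <= X)%N](_ : _ =
  (m * k j) * (m ^ (\sum_i k' i) * \prod_i (k' i)`!))%N; last by ring.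
exact: leq_mul.
Qed.

Lemma fact_ratio_le m a b : (m <= a.+1)%N -> (a <= b)%N ->
  (a`! * m ^ b <= b`! * m ^ a)%N.
Proof.
move=> ma; elim: b => [|b IH]; first by rewrite leqn0 => /eqP ->.
rewrite leq_eqVlt => /orP[/eqP <- //|]; rewrite ltnS => ab.
rewrite factS expnS mulnCA -mulnA leq_mul ?IH //.
by apply: leq_trans ma _; rewrite ltnS.
Qed.

Lemma fact_le_exp a b : (a <= b)%N -> (b`! <= b ^ (b - a) * a`!)%N.
Proof.
elim: b => [|b IH]; first by rewrite leqn0 => /eqP ->.
rewrite leq_eqVlt => /orP[/eqP <-|]; first by rewrite subnn mul1n.
rewrite ltnS => ab; rewrite factS subSn // expnS -mulnA leq_mul //.
apply: leq_trans (IH ab) _; rewrite leq_mul //.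
by have [|] := posnP (b - a); [move=> -> | move=> h; rewrite leq_exp2r].
Qed.

Section Real.
Variable R : realType.
Implicit Types x C A U : R.

Lemma exp_ge_term x n : 0 <= x -> x ^+ n / n`!%:R <= expR x.
Proof.
case: n => [|n] x0; first by rewrite expr0 fact0 divr1 -[1]addr0; apply: le_trans (expR_ge1Dx x); rewrite lerD2l.
by apply: le_trans (expR_ge1Dxn n x0); rewrite lerDr.
Qed.

(** exp(2x) bounds (2x)^n / n!, which gains 2^n over x^n / n!. *)
Lemma fact_ge_power x C : 0 <= x -> exists n, C * x ^+ n <= n`!%:R.
Proof.
move=> x0; pose y := `|C| * expR (2 * x).
have y0 : 0 <= y by rewrite mulr_ge0 ?expR_ge0.
pose n := Num.bound y; exists n.
have yn : y < 2 ^+ n.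
  apply: lt_le_trans (archi_boundP y0) _; rewrite -natrX ler_nat.
  by apply: ltnW; apply: ltn_expl.
have f0 : (0 : R) < n`!%:R by rewrite ltr0n fact_gt0.
have := @exp_ge_term (2 * x) n; rewrite mulr_ge0 // => /(_ isT).
rewrite ler_pdivrMr // exprMn => H.
apply: (@le_trans _ _ (`|C| * x ^+ n)); first by rewrite ler_wpM2r ?exprn_ge0 // ler_norm.
have p0 : (0 : R) < 2 ^+ n by rewrite exprn_gt0.
rewrite -(ler_pM2l p0) mulrCA; apply: le_trans (ler_wpM2l (normr_ge0 _) H) _.
by rewrite mulrA ler_wpM2r // ltW.
Qed.

Lemma exp2_gt_power d C : exists L0, forall L, (L0 <= L)%N -> C * L%:R ^+ d < 2 ^+ L.
Proof.
have l2 : 0 < ln 2 :> R by rewrite ln_gt0 // ltr1n.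
pose c : R := ln 2 ^+ d.+1 / d.+1`!%:R.
have f0 : (0 : R) < d.+1`!%:R by rewrite ltr0n fact_gt0.
have c0 : 0 < c by rewrite divr_gt0 // exprn_gt0.
exists (Num.bound (`|C| / c)).+1 => L LL.
have L0 : (0 : R) < L%:R by rewrite ltr0n; lia.
have CL : C < c * L%:R.
  rewrite mulrC -ltr_pdivrMr //.
  apply: le_lt_trans (_ : `|C| / c < _); first by rewrite ler_pM2r ?invr_gt0 // ler_norm.
  apply: lt_le_trans (archi_boundP _) _; first by rewrite divr_ge0 // ltW.
  by rewrite ler_nat ltnW.
have E : expR (ln 2 * L%:R) = 2 ^+ L :> R by rewrite expRM_natr lnK // posrE ltr0n.
rewrite -E; apply: lt_le_trans (_ : c * L%:R * L%:R ^+ d <= _).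
  by rewrite ltr_pM2r // exprn_gt0.
apply: le_trans (exp_ge_term d.+1 _); last by rewrite mulr_ge0 // ltW.
by rewrite exprMn [L%:R ^+ d.+1]exprS /c le_eqVlt; apply/orP; left; apply/eqP; ring.
Qed.

Lemma pow_le_fact_exp n : n%:R ^+ n <= n`!%:R * expR n%:R :> R.
Proof.
have f0 : (0 : R) < n`!%:R by rewrite ltr0n fact_gt0.
by rewrite mulrC -ler_pdivrMr // exp_ge_term.
Qed.

Lemma double_le_exp x : 0 <= x -> 2 * x <= expR x.
Proof.
move=> x0; have -> : expR x = expR (x / 2) ^+ 2.
  by rewrite -expRM_natr divfK.
have H : 0 <= 1 + x / 2 by rewrite addr_ge0 // divr_ge0.
apply: (@le_trans _ _ ((1 + x / 2) ^+ 2)).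
  by rewrite -subr_ge0 (_ : _ - _ = (1 - x / 2) ^+ 2) ?sqr_ge0 //; field.
by rewrite lerXn2r ?nnegrE ?expR_ge0 // expR_ge1Dx.
Qed.

(** From K^K <= K! e^K the hypothesis gives K (log K - 1 - v) < X, so that K is
    about X / log X; the factor 2 absorbs the lower order terms once log X is
    large compared with vmax. *)
Lemma factorial_inverse_bound (vmax : R) : exists Y0 : R, forall (K : nat) (X v : R),
  Y0 <= ln X -> 0 < X -> v <= vmax ->
  K`!%:R < expR (X + K%:R * v) -> K.+1%:R <= 2 * X / ln X.
Proof.
pose c0 := ln (16 : R) + vmax.
exists (Num.max 1 (6 * c0)) => K X v; set Y := ln X.
rewrite ge_max => /andP[Y1 Yc] X0 vv HK; rewrite leNgt; apply/negP => HX.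
have Y0 : 0 < Y by apply: lt_le_trans Y1.
(* At scale Y = log X, the quotient X / Y is e^Y / Y >= 2, so K >= 2 X / Y - 1
   is at least (3/2) X / Y, while log K >= Y - log Y. *)
have XE : X = expR Y by rewrite /Y lnK.
have XY : 2 <= X / Y by rewrite ler_pdivlMr // XE double_le_exp // ltW.
have K15 : 3 / 2 * (X / Y) <= K%:R.
  have HX1 : 2 * (X / Y) < K%:R + 1 by rewrite natr1 mulrA.
  by move: HX1 XY; set q := X / Y; set k := K%:R => *; lra.
have K1 : 1 <= K%:R :> R by lra.
have K0 : (0 : R) < K%:R by lra.
have qK : X / Y <= K%:R by move: XY K15; set q := X / Y => *; lra.
have lnK1 : Y - ln Y <= ln K%:R.
  by rewrite -{1}[Y]/(ln X) -ln_div ?posrE // ler_ln ?posrE ?divr_gt0.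
have lnY : ln Y <= Y / 16 - 1 + ln 16.
  have -> : ln Y = ln (1 + (Y / 16 - 1)) + ln 16.
    by rewrite -lnM ?posrE ?ltr0n //; [congr ln; field | lra].
  by rewrite lerD2r le_ln1Dx //; lra.
have key : K%:R * (ln K%:R - 1 - v) < X.
  have H : expR (K%:R * ln K%:R) < expR (X + K%:R * v + K%:R).
    rewrite expRM_natl lnK ?posrE // expRD; apply: le_lt_trans (pow_le_fact_exp K) _.
    by rewrite ltr_pM2r ?expR_gt0.
  by move: H; rewrite ltr_expR; lra.
have low : 3 / 4 * Y <= ln K%:R - 1 - v by move: Yc; rewrite /c0; lra.
have : 3 / 2 * (X / Y) * (3 / 4 * Y) <= K%:R * (ln K%:R - 1 - v).
  by apply: ler_pM => //; [rewrite mulr_ge0 //; lra | lra].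
have -> : 3 / 2 * (X / Y) * (3 / 4 * Y) = 9 / 8 * X by field; rewrite gt_eqF.
lra.
Qed.

End Real.

(** * Choice of the parameters *)

Section Choice.
Variable R : realType.

(** The product of the (n_j - 1)! is at least the factorial of their sum divided
    by a power of m, and this sum is at least L + 1 - m. *)
Lemma fact_le_of_sum_gt m (n : 'I_m -> nat) (L : nat) (c : R) (h : 'I_m -> R) :
  0 <= c -> (forall j, 0 <= h j) -> (forall j, (0 < n j)%N) ->
  (forall j, ((n j).-1)`!%:R <= c * h j) -> (2 * m <= L)%N -> (L < \sum_j n j)%N ->
  L`!%:R <= (c * L%:R) ^+ m * m%:R ^+ L * \prod_j h j.
Proof.
move=> c0 h0 n0 Hn mL LN.
pose K := (\sum_j (n j).-1)%N.
have NK : (\sum_j n j = K + m)%N.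
  have -> : (\sum_j n j = \sum_j ((n j).-1 + 1))%N.
    by apply: eq_bigr => j _; rewrite addn1 prednK.
  by rewrite big_split /= sum1_card card_ord.
(* The sum K of the n_j - 1 is at least K', and k! / m^k increases for k >= m - 1. *)
pose K' := (L.+1 - m)%N.
have KK : (K' <= K)%N by rewrite /K'; lia.
have m0 : (0 < m)%N.
  by move: LN; case: (m) n {h h0 n0 Hn mL NK K KK} => // n; rewrite big_ord0.
have Q1 : K`!%:R <= m%:R ^+ K * (c ^+ m * \prod_j h j) :> R.
  have := multinomial_le (fun j => (n j).-1); rewrite -/K -(ler_nat R) natrM natrX => Hm.
  apply: le_trans Hm _; rewrite ler_wpM2l ?exprn_ge0 // natr_prod.
  have -> : c ^+ m * \prod_j h j = \prod_j (c * h j).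
    by rewrite big_split /= prodr_const card_ord.
  by apply: ler_prod => j _; rewrite ler0n Hn.
have Q2 : K'`!%:R <= m%:R ^+ K' * (c ^+ m * \prod_j h j) :> R.
  have mK : (m <= K'.+1)%N by rewrite /K'; lia.
  have := fact_ratio_le mK KK; rewrite -(ler_nat R) !natrM !natrX => Hr.
  have p0 : (0 : R) < m%:R ^+ K by rewrite exprn_gt0 // ltr0n.
  rewrite -(ler_pM2r p0); apply: le_trans Hr _.
  apply: le_trans (ler_wpM2r _ Q1) _; first exact: exprn_ge0.
  by rewrite le_eqVlt; apply/orP; left; apply/eqP; ring.
have Q3 : L`!%:R <= L%:R ^+ m * K'`!%:R :> R.
  rewrite -natrX -natrM ler_nat; apply: leq_trans (fact_le_exp (_ : K' <= L)%N) _.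
    by rewrite /K'; lia.
  by rewrite leq_mul2r leq_pexp2l ?orbT //; rewrite /K'; lia.
apply: le_trans Q3 _; apply: le_trans (ler_wpM2l _ Q2) _; first exact: exprn_ge0.
have ch0 : 0 <= \prod_j h j by apply: prodr_ge0.
rewrite exprMn.
apply: (@le_trans _ _ (L%:R ^+ m * (m%:R ^+ L * (c ^+ m * \prod_j h j)))).
  rewrite ler_wpM2l ?exprn_ge0 // ler_wpM2r ?mulr_ge0 ?exprn_ge0 //.
  by rewrite ler_weXn2l ?ler1n // /K'; lia.
by rewrite le_eqVlt; apply/orP; left; apply/eqP; ring.
Qed.

(** L is the least integer with L! >= H V^L, V = 2 m U^m. The factor 2^L in V beats
    the polynomial losses of fact_le_of_sum_gt, which forces the minimal n_j to
    have sum at most L; minimality of L gives (L-1)! < H V^(L-1), hence both the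
    upper bound for L! and, by factorial_inverse_bound, the one for L. *)
Lemma choose_parameters (m : nat) (A Umax : R) : (1 <= m)%N -> 0 < A -> 1 <= Umax ->
  exists2 H0 : R, 0 < H0 & forall (U : R) (h : 'I_m -> R),
    1 <= U <= Umax -> (forall j, 1 <= h j) -> H0 <= \prod_j h j ->
    let X := ln (\prod_j h j) in
    [/\ 0 < X, 0 < ln X & exists (L : nat) (n : 'I_m -> nat),
    [/\ forall j, (0 < n j)%N, (\sum_j n j <= L)%N,
        forall j, 2 * m%:R * A * L%:R * U ^+ L * h j <= (n j)`!%:R &
        2 * A * L`!%:R * U ^+ L <
          expR (X + 2 * X / ln X * (ln (2 * m%:R) + (m.+1)%:R * ln U + 1))]].
Proof.
move=> m1 A0 Um1.
have mR : (0 : R) < m%:R by rewrite ltr0n.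
have mR1 : (1 : R) <= m%:R by rewrite ler1n.
pose vmax : R := ln (2 * m%:R * Umax ^+ m).
have [Y0 HY0] := factorial_inverse_bound vmax.
have [La HLa] := exp2_gt_power (2 * m) ((2 * m%:R * A) ^+ m : R).
have [Lb HLb] := exp2_gt_power 1 (2 * A : R).
have [Lc HLc] : exists Lc : nat, A^-1 <= Lc%:R.
  by exists (Num.bound A^-1); apply/ltW/archi_boundP; rewrite invr_ge0 ltW.
have [L0 [LaL0 LbL0 LcL0 mL0]] : exists L0, [/\ La <= L0, Lb <= L0, Lc <= L0 & 2 * m <= L0]%N.
  by exists (La + Lb + Lc + 2 * m)%N; split; lia.
(* H >= exp (exp Y1) gives log log H >= Y1, and H > L0! keeps L above L0. *)
pose Y1 := Num.max 1 Y0.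
pose H0 : R := expR (expR Y1) + L0`!%:R + 1.
have H00 : 0 < H0 by rewrite !addr_gt0 ?expR_gt0 ?ltr0n ?fact_gt0.
exists H0 => // U h /andP[U1 Um] h1 HH X.
set H := \prod_j h j in HH X *.
have Hpos : 0 < H by apply: lt_le_trans HH.
have XY1 : expR Y1 <= X.
  rewrite -[expR Y1]expRK ler_ln ?posrE ?expR_gt0 //; apply: le_trans HH.
  by rewrite /H0 -addrA lerDl addr_ge0.
have X0 : 0 < X by apply: lt_le_trans XY1; apply: expR_gt0.
have YY1 : Y1 <= ln X by rewrite -[Y1]expRK ler_ln ?posrE ?expR_gt0.
have Y1_ge1 : 1 <= Y1 by rewrite /Y1 le_max lexx.
have Ypos : 0 < ln X by lra.
split=> //.
pose V : R := 2 * m%:R * U ^+ m.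
have U0 : 0 < U by lra.
have V0 : 0 < V by rewrite !mulr_gt0 ?exprn_gt0.
have V1 : 1 <= V by rewrite mulr_ege1 ?exprn_ege1 //; lra.
have exL : exists L, H * V ^+ L <= L`!%:R by apply: fact_ge_power; lra.
case: (ex_minnP exL) => L HL Lmin.
have L0L : (L0 <= L)%N.
  rewrite leqNgt; apply/negP => LL.
  have : L`!%:R < H.
    apply: le_lt_trans (_ : L0`!%:R < _); first by rewrite ler_nat leq_fact // ltnW.
    apply: lt_le_trans HH; rewrite /H0; have := expR_gt0 (expR Y1); lra.
  by rewrite ltNge (le_trans _ HL) // ler_peMr ?exprn_ege1 // ltW.
have Lpos : (0 < L)%N by apply: leq_trans L0L; apply: leq_trans mL0; rewrite muln_gt0.
have LR : (0 : R) < L%:R by rewrite ltr0n.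
(* c > 1 makes every minimal n_j positive. *)
pose c : R := 2 * m%:R * A * L%:R * U ^+ L.
have AL : 1 <= A * L%:R.
  have h2 : A^-1 <= L%:R.
    by apply: le_trans HLc _; rewrite ler_nat; apply: leq_trans L0L.
  by rewrite -[leLHS](mulfV (lt0r_neq0 A0)) ler_wpM2l // ltW.
have c1 : 1 < c.
  apply: (@lt_le_trans _ _ (2 * (m%:R * (A * L%:R) * U ^+ L))); last first.
    by rewrite /c le_eqVlt; apply/orP; left; apply/eqP; ring.
  have : 1 <= m%:R * (A * L%:R) * U ^+ L.
    by apply: mulr_ege1; [apply: mulr_ege1|apply: exprn_ege1].
  by lra.
have exn j : exists k, c * h j <= k`!%:R.
  by have [k Hk] := fact_ge_power (c * h j) (ler01 : 0 <= 1 :> R); exists k; rewrite expr1n mulr1 in Hk.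
pose n j := ex_minn (exn j).
have c0 : 0 <= c by apply: ltW; apply: lt_trans c1.
have ch1 j : 1 < c * h j by apply: (lt_le_trans c1); rewrite ler_peMr.
have nP j : [/\ (0 < n j)%N, c * h j <= (n j)`!%:R & ((n j).-1)`!%:R <= c * h j].
  rewrite /n; case: ex_minnP => k Hk kmin.
  have k0 : (0 < k)%N.
    by case: k Hk {kmin} => //; rewrite fact0 => /(lt_le_trans (ch1 j)); rewrite ltxx.
  split=> //; rewrite leNgt; apply/negP => /ltW /kmin; by rewrite leqNgt ltn_predL k0.
exists L, n; split.
- by move=> j; case: (nP j).
- rewrite leqNgt; apply/negP => LN.
  have := fact_le_of_sum_gt (c := c) (h := h) (L := L) (n := n).
  move=> /(_ c0 (fun j => le_trans ler01 (h1 j))) Hf.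
  have {}Hf := Hf (fun j => let: And3 p _ _ := nP j in p) (fun j => let: And3 _ _ p := nP j in p).
  have mL : (2 * m <= L)%N by apply: leq_trans L0L.
  have {}Hf := Hf mL LN.
  have := le_trans HL Hf; rewrite -/H [leRHS]mulrC ler_pM2l //.
  rewrite /V /c leNgt; apply/negP/negPn.
  rewrite [ltLHS](_ : _ = ((2 * m%:R * A) ^+ m * L%:R ^+ (2 * m)) * (m%:R ^+ L * (U ^+ m) ^+ L)); last first.
    by rewrite (exprM L%:R 2 m) expr2 -(exprM U m L) (mulnC m L) (exprM U L m) !exprMn; ring.
  rewrite [ltRHS](_ : _ = 2 ^+ L * (m%:R ^+ L * (U ^+ m) ^+ L)); last by rewrite !exprMn mulrA.
  rewrite ltr_pM2r ?mulr_gt0 ?exprn_gt0 //.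
  by apply: HLa; apply: leq_trans L0L.
- by move=> j; case: (nP j).
have HL1 : (L.-1)`!%:R < H * V ^+ L.-1.
  by rewrite ltNge; apply/negP => /Lmin; rewrite leqNgt ltn_predL Lpos.
have LXY : L%:R <= 2 * X / ln X.
  rewrite -(prednK Lpos); apply: (HY0 _ _ (ln V)) => //.
  - by apply: le_trans YY1; rewrite /Y1 le_max lexx orbT.
  - rewrite /vmax ler_ln ?posrE ?mulr_gt0 ?exprn_gt0 //; last lra.
    by rewrite ler_pM2l ?mulr_gt0 // lerXn2r ?nnegrE //; lra.
  - by rewrite expRD expRM_natl !lnK.
have W0 : 0 <= ln (2 * m%:R) + m.+1%:R * ln U + 1 :> R.
  by rewrite !addr_ge0 ?mulr_ge0 ?ln_ge0 //; lra.
apply: (@lt_le_trans _ _ (expR (X + L%:R * (ln (2 * m%:R) + (m.+1)%:R * ln U + 1)))); last first.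
  by rewrite ler_expR lerD2l ler_wpM2r.
have lnVU : ln (2 * m%:R) + m.+1%:R * ln U = ln (V * U).
  have -> : V * U = (2 * m%:R) * U ^+ m.+1 by rewrite /V exprSr mulrA.
  by rewrite [RHS]lnM ?posrE ?mulr_gt0 ?exprn_gt0 // lnXn // (mulr_natl (ln U)).
rewrite lnVU expRD /X lnK ?posrE // expRM_natl expRD lnK ?posrE ?(mulr_gt0 V0 U0) // exprMn.
have e1 : 2 * A * L%:R < expR 1 ^+ L.
  have := HLb L; rewrite expr1 => /(_ _) hb.
  apply: lt_le_trans (hb _) _; first exact: leq_trans L0L.
  by rewrite lerXn2r ?nnegrE ?expR_ge0 //; apply: expR_ge1Dx.
have -> : L`!%:R = L%:R * (L.-1)`!%:R :> R by rewrite -{1}(prednK Lpos) factS prednK // natrM.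
apply: (@lt_trans _ _ (expR 1 ^+ L * ((L.-1)`!%:R * U ^+ L))).
  rewrite [ltLHS](_ : _ = (2 * A * L%:R) * ((L.-1)`!%:R * U ^+ L)); last by ring.
  by rewrite ltr_pM2r // mulr_gt0 ?exprn_gt0 // ltr0n fact_gt0.
rewrite [ltRHS](_ : _ = expR 1 ^+ L * ((H * V ^+ L) * U ^+ L)); last by rewrite exprMn; ring.
rewrite ltr_pM2l ?exprn_gt0 ?expR_gt0 // ltr_pM2r ?exprn_gt0 //.
apply: lt_le_trans HL1 _; by rewrite ler_pM2l // ler_weXn2l // leq_pred.
Qed.

End Choice.

(** * Nonzero integer combinations *)

Section LinearForm.
Variables (R : realType) (L : fieldExtType rat) (iota : {rmorphism L -> R[i]}).
Variables (a b : L).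
Hypothesis HL : rational_or_imaginary_quadratic iota.
Hypothesis a_int : algebraic_integer a.
Hypothesis b_int : algebraic_integer b.
Hypothesis b0 : b != 0.

Lemma algebraic_integerX (y : L) k : algebraic_integer y -> algebraic_integer (y ^+ k).
Proof.
move=> yi; elim: k => [|k IH]; first exact: (integral1 (intr : {rmorphism int -> L})).
by rewrite exprS; apply: integral_mul.
Qed.

Lemma algebraic_integer_sum I (r : seq I) (F : I -> L) :
  (forall i, algebraic_integer (F i)) -> algebraic_integer (\sum_(i <- r) F i).
Proof.
move=> H; elim/big_ind: _ => // [|y z yi zi].
  exact: (mxpoly.integral0 (intr : {rmorphism int -> L})).
exact: integral_add.
Qed.

Lemma clear_denominator (p : {poly int}) d : (size p <= d.+1)%N ->
  exists2 y : L, algebraic_integer y &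
    iota y = iota b ^+ d * (map_poly intr p).[iota a / iota b].
Proof.
move=> sp; exists (\sum_(k < d.+1) (p`_k)%:~R * (a ^+ k * b ^+ (d - k))).
  apply: algebraic_integer_sum => k; apply: integral_mul.
    exact: (integral_id (intr : {rmorphism int -> L})).
  by apply: integral_mul; apply: algebraic_integerX.
have sp' : (size (map_poly (intr : int -> R[i]) p) <= d.+1)%N.
  by apply: leq_trans (size_poly _ _) sp.
rewrite (horner_coef_wide _ sp') rmorph_sum mulr_sumr; apply: eq_bigr => k _.
rewrite !rmorphM !rmorphXn /= rmorph_int coef_map /= exprMn exprVn.
have kd : (k <= d)%N by rewrite -ltnS.
have ib : iota b != 0 by rewrite fmorph_eq0.
have -> : iota b ^+ d = iota b ^+ (d - k) * iota b ^+ k by rewrite -exprD subnK.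
by field; rewrite expf_neq0.
Qed.

(** Since the determinant does not vanish, some system combines with beta to a
    nonzero value, which is the image of an integer of L divided by b^d. Its
    distance to the denominator times the linear form is at most the sum of the
    h_j eps_j, half of the lower bound |b|^(-d) for its modulus. *)
Lemma linear_form_ge (m d : nat) (q : 'I_m.+1 -> {poly int})
    (p : 'I_m.+1 -> 'I_m -> {poly int}) (f : 'I_m -> R[i]) (x : R[i])
    (Q : R) (eps h : 'I_m -> R) (beta : 'I_m.+1 -> L) :
  x = iota a / iota b ->
  (forall i, (size (q i) <= d.+1)%N) -> (forall i j, (size (p i j) <= d.+1)%N) ->
  \det (value_mx q p x) != 0 ->
  (forall i, cmod (map_poly intr (q i)).[x] <= Q) ->
  (forall i j, cmod ((map_poly intr (q i)).[x] * f j - (map_poly intr (p i j)).[x]) <= eps j) ->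
  (forall j, algebraic_integer (beta j)) -> (exists j, beta j != 0) ->
  (forall j, cmod (iota (beta (lift ord0 j))) <= h j) ->
  cmod (iota b) ^+ d * \sum_j h j * eps j <= 2^-1 ->
  2^-1 <= cmod (iota b) ^+ d * Q *
    cmod (iota (beta ord0) + \sum_j iota (beta (lift ord0 j)) * f j).
Proof.
move=> xE sq sp det0 HQ Heps beta_int [j0 bj0] Hh Hsmall.
pose v i := (map_poly intr (q i)).[x] * iota (beta ord0) +
  \sum_j (map_poly intr (p i j)).[x] * iota (beta (lift ord0 j)).
have [i vi] : exists i, v i != 0.
  apply/existsP; rewrite -[[exists i, _]]negbK negb_exists; apply/negP => /forallP Hv.
  pose w : 'cV[R[i]]_m.+1 := \col_i iota (beta i).
  have Mw : value_mx q p x *m w = 0.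
    apply/matrixP => i k; rewrite !mxE big_ord_recl !mxE unlift_none.
    transitivity (v i); last by apply/eqP; have := Hv i; rewrite negbK.
    by congr (_ + _); apply: eq_bigr => j _; rewrite !mxE liftK.
  have U : value_mx q p x \in unitmx by rewrite unitmxE unitfE.
  have := mulKmx U w; rewrite Mw mulmx0 => /matrixP /(_ j0 0); rewrite !mxE => /esym /eqP.
  by rewrite fmorph_eq0 (negPf bj0).
have [Y Yint YE] : exists2 Y : L, algebraic_integer Y & iota Y = iota b ^+ d * v i.
  have [y0 y0i y0E] := clear_denominator (sq i).
  have Hy j : exists y, algebraic_integer y /\
      iota y = iota b ^+ d * (map_poly intr (p i j)).[iota a / iota b].
    by have [y yi yE] := clear_denominator (sp i j); exists y.
  have [y yP] := choice Hy.
  exists (y0 * beta ord0 + \sum_j y j * beta (lift ord0 j)).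
    apply: integral_add; first exact: integral_mul y0i (beta_int _).
    apply: (@algebraic_integer_sum _ _ (fun j => y j * beta (lift ord0 j))) => j.
    by apply: integral_mul; [exact: (proj1 (yP j))|exact: beta_int].
  rewrite rmorphD rmorphM rmorph_sum /= y0E /v mulrDr -xE mulrA; congr (_ + _).
  rewrite mulr_sumr; apply: eq_bigr => j _.
  by rewrite rmorphM /= (proj2 (yP j)) -xE mulrA.
have Y0 : Y != 0.
  by rewrite -(fmorph_eq0 iota) YE mulf_neq0 ?expf_neq0 ?fmorph_eq0.
have := integer_norm_ge1 HL Yint Y0; rewrite YE cmodM cmodX => H1.
set Lam := _ + _.
have E : v i = (map_poly intr (q i)).[x] * Lam -
   \sum_j iota (beta (lift ord0 j)) * ((map_poly intr (q i)).[x] * f j - (map_poly intr (p i j)).[x]).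
  rewrite /v /Lam mulrDr -addrA; congr (_ + _).
  rewrite mulr_sumr -sumrB; apply: eq_bigr => j _; ring.
have B0 : 0 <= cmod (iota b) ^+ d by rewrite exprn_ge0 // cmod_ge0.
have le1 : cmod (v i) <= Q * cmod Lam + \sum_j h j * eps j.
  rewrite E; apply: le_trans (cmodD _ _) _; rewrite cmodM cmodN; apply: lerD.
    by rewrite ler_wpM2r ?cmod_ge0.
  apply: le_trans (cmod_sum _ _ _) _; apply: ler_sum => j _.
  by rewrite cmodM ler_pM ?cmod_ge0.
have le2 := ler_wpM2l B0 le1; rewrite mulrDr mulrA in le2.
have := le_trans H1 le2; move: Hsmall.
set u := _ * \sum_j _; set t := _ * cmod Lam => *; lra.
Qed.

End LinearForm.

Section Denominator.
Variables (R : realType) (alpha : R[i]).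

(** D is read off from any one representation of alpha. As integrality over the
    integers does not depend on the field, D alpha is integral in every field
    containing alpha. *)
Lemma uniform_denominator : exists2 D : nat, (0 < D)%N &
  forall (L : fieldExtType rat) (iota : {rmorphism L -> R[i]}) (a b : L),
    rational_or_imaginary_quadratic iota ->
    algebraic_integer a -> algebraic_integer b -> b != 0 -> alpha = iota a / iota b ->
    exists a' b' : L, [/\ algebraic_integer a', algebraic_integer b', b' != 0,
      alpha = iota a' / iota b' & cmod (iota b') <= D%:R /\ cmod (iota b') <= cmod (iota b)].
Proof.
have [[L1 [iota1 [a1 [b1 [a1i b1i b10 E1]]]]]|none] := pselect (exists (L : fieldExtType rat)
  (iota : {rmorphism L -> R[i]}) (a b : L),
  [/\ algebraic_integer a, algebraic_integer b, b != 0 & alpha = iota a / iota b]); last first.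
  exists 1%N => // L iota a b _ ai bi b0 E; case: none; by exists L, iota, a, b.
have [D D0 Dint] := integral_denominator b10 b1i.
exists D => // L iota a b HL ai bi b0 E.
have [bD|Db] := lerP (cmod (iota b)) D%:R; first by exists a, b.
have ib : iota b != 0 by rewrite fmorph_eq0.
have DL : D%:R != 0 :> L by rewrite -(fmorph_eq0 iota) rmorph_nat pnatr_eq0 -lt0n.
exists (D%:R * a / b), D%:R; split=> //.
- apply: (integralOver_inj (f := iota)).
  rewrite -mulrA rmorphM fmorph_div /= -E rmorph_nat.
  have -> : D%:R * alpha = iota1 (a1 * (D%:R / b1)).
    by rewrite E1 rmorphM fmorph_div /= rmorph_nat mulrCA [in RHS]mulrCA; ring.
  by apply: integralOver_morph; apply: integral_mul.
- exact: (integral_nat (intr : {rmorphism int -> L})).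
- by rewrite E rmorphM rmorphM fmorphV /=; field; rewrite ib andbT pnatr_eq0 -lt0n.
have -> : cmod (iota D%:R) = D%:R :> R.
  by rewrite rmorph_nat -(ratr_nat R[i]) cmod_ratr normr_nat ratr_nat.
by split=> //; apply: ltW.
Qed.

End Denominator.

(** * The lower bound *)

(** Here u stands for log U, so the left side is twice the exponential rate of
    L! U^L / H per unit of L, the factor 2 coming from L <= 2 log H / log log H. All
    terms are compared monomial by monomial using m, S >= 1 and log 2 <= 1. *)
Lemma log_constants_le (R : realType) (m : nat) (S : R) (bz x : R[i]) (u : R) :
  (1 <= m)%N -> 1 <= S -> 0 <= ln (cmod bz) -> 
  u <= 4 * S * ln 2 + 2 * ln S + (m%:R + 3) * ln 2 + 2 * ln (Num.max 1 (cmod x)) + ln (cmod bz) ->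
  2 * (ln (2 * m%:R) + m.+1%:R * u + 1) <=
  6 * (d0 S bz + d1 S bz x * m%:R + d2 S * m%:R ^+ 2).
Proof.
move=> m1 S1 lb0 Hu; rewrite /d0 /d1 /d2.
have M1 : 1 <= m%:R :> R by rewrite ler1n.
have l2_0 : 0 <= ln 2 :> R by rewrite ln_ge0 // ler1n.
have l2_1 : ln 2 <= 1 :> R by have := @le_ln1Dx R 1; apply; lra.
have lS0 : 0 <= ln S by rewrite ln_ge0.
have la0 : 0 <= ln (Num.max 1 (cmod x)) by rewrite ln_ge0 // le_max lexx.
have lm : ln (2 * m%:R) <= ln 2 + m%:R :> R.
  rewrite lnM ?posrE ?ltr0n // lerD2l; apply: ltW; apply: ln_sublinear.
  by rewrite ltr0n.
rewrite -[m.+1%:R]natr1.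
move: Hu lm lb0 la0 lS0 l2_0 l2_1 M1 S1.
move: (m%:R : R) (ln (cmod bz)) (ln (Num.max _ _)) (ln S) (ln 2 : R) (ln (2 * m%:R)).
move=> M lb la lS l2 lm Hu Hlm lb0 la0 lS0 l20 l21 M1 S1.
have H1 : (M + 1) * u <= (M + 1) * (4 * S * l2 + 2 * lS + (M + 3) * l2 + 2 * la + lb).
  by rewrite ler_wpM2l //; lra.
apply: (@le_trans _ _ (2 * (l2 + M + (M + 1) * (4 * S * l2 + 2 * lS + (M + 3) * l2 + 2 * la + lb) + 1))).
  by lra.
have p1 : S * l2 <= S by rewrite ler_piMr //; lra.
have p2 : M * (S * l2) <= M * S by rewrite ler_wpM2l //; lra.
have p3 : M ^+ 2 * l2 <= M ^+ 2 by rewrite ler_piMr // sqr_ge0.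
have p4 : M * l2 <= M by rewrite ler_piMr //; lra.
have p5 : M ^+ 2 <= M ^+ 2 * S by rewrite ler_peMr // sqr_ge0.
have p6 : M <= M * S by rewrite ler_peMr //; lra.
have p7 : 0 <= M * lS by rewrite mulr_ge0 //; lra.
have p8 : 0 <= M * lb by rewrite mulr_ge0 //; lra.
have p9 : la <= M * la by rewrite ler_peMl.
have p10 : 0 <= M ^+ 2 * lS by rewrite mulr_ge0 // sqr_ge0.
have p11 : 0 <= M ^+ 2 * S ^+ 2 by rewrite mulr_ge0 // sqr_ge0.
have p12 : 0 <= M * l2 by rewrite mulr_ge0 //; lra.
have p13 : 0 <= M ^+ 2 by rewrite sqr_ge0.
move: p13 p1 p2 p3 p4 p5 p6 p7 p8 p9 p10 p11 p12; clear Hu H1.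
have -> : (M + 1) * (4 * S * l2 + 2 * lS + (M + 3) * l2 + 2 * la + lb) =
  4 * (M * (S * l2)) + 4 * (S * l2) + 2 * (M * lS) + 2 * lS + M ^+ 2 * l2 + 4 * (M * l2) + 3 * l2
  + 2 * (M * la) + 2 * la + M * lb + lb by ring.
have -> : 6 * (3 + 3 * l2 + 5 * lS + 36 * S + lb +
    (1 + 6 * l2 + 9 * lS + 36 * S + lb + 2 * la) * M + (2 * lS + 6 * S + 6 * S ^+ 2) * M ^+ 2) =
  18 + 18 * l2 + 30 * lS + 216 * S + 6 * lb + 6 * M + 36 * (M * l2) + 54 * (M * lS)
  + 216 * (M * S) + 6 * (M * lb) + 12 * (M * la) + 12 * (M ^+ 2 * lS) + 36 * (M ^+ 2 * S)
  + 36 * (M ^+ 2 * S ^+ 2) by ring.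
move: (M ^+ 2) (M ^+ 2 * S ^+ 2) (M ^+ 2 * S) (M ^+ 2 * lS) (M * S) (M * lb) (M * la) (M * l2)
  (M ^+ 2 * l2) (M * lS) (S * l2) (M * (S * l2)) => *.
lra.
Qed.

Lemma ln_growth (R : realType) (m S : nat) (x : R[i]) : (1 <= S)%N ->
  ln (growth m S x) = 4 * S%:R * ln 2 + 2 * ln S%:R + (m%:R + 3) * ln 2 +
    2 * ln (Num.max 1 (cmod x)) :> R.
Proof.
move=> S1; have S0 : (0 : R) < S%:R by rewrite ltr0n.
have x0 : 0 < Num.max 1 (cmod x) by rewrite lt_max ltr01.
rewrite /growth !lnM ?posrE ?mulr_gt0 ?exprn_gt0 //.
have lnXE k (y : R) : 0 < y -> ln (y ^+ k) = k%:R * ln y by move=> y0; rewrite lnXn // mulr_natl.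
by rewrite !lnXE // (_ : 16 = 2 ^+ 4 :> R) ?lnXE // ?natrD; ring.
Qed.

Lemma growth_ge1 (R : realType) (m S : nat) (x : R[i]) : (1 <= S)%N -> 1 <= growth m S x :> R.
Proof.
move=> S1; rewrite /growth.
have mx : 1 <= Num.max 1 (cmod x) by rewrite le_max lexx.
by apply: mulr_ege1; [apply: mulr_ege1; [apply: mulr_ege1|]|]; rewrite exprn_ege1 // ler1n.
Qed.

Theorem theorem1 (R : realType) (m : nat) (lambda : 'I_m -> rat)
    (alpha : R[i]) :
  (1 <= m)%N ->
  (forall j, ~ (lambda j \is a Num.int /\ lambda j < 0)) ->
  (forall i j, i != j -> lambda i - lambda j \isn't a Num.int) ->
  alpha != 0 ->
  exists2 H0 : R, 0 < H0 &
    forall (L : fieldExtType rat) (iota : {rmorphism L -> R[i]}) (a b : L),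
    rational_or_imaginary_quadratic iota ->
    algebraic_integer a -> algebraic_integer b -> b != 0 ->
    alpha = iota a / iota b ->
    let S : R := (max_denom lambda)%:R in
    let e0 := d0 S (iota b) in
    let e1 := d1 S (iota b) alpha in
    let e2 := d2 S in
    forall beta : 'I_m.+1 -> L,
    (forall j, algebraic_integer (beta j)) ->
    (exists j, beta j != 0) ->
    let H : R := \prod_(j < m) Num.max 1 (cmod (iota (beta (lift ord0 j)))) in
    H0 <= H ->
    cmod (iota (beta ord0)
          + \sum_(j < m) iota (beta (lift ord0 j)) * phi (lambda j) alpha)
    > H `^ (- 1 - 6 * (e0 + e1 * m%:R + e2 * m%:R ^+ 2) / ln (ln H)).
Proof.
move=> m1 Hneg Hdiff alpha0.
pose Sn := max_denom lambda.
have den_le j : (`|denq (lambda j)| <= Sn)%N by exact: (leq_bigmax j).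
have S1 : (1 <= Sn)%N.
  by apply: leq_trans (den_le (Ordinal m1)); rewrite absz_gt0 denq_neq0.
have SR : 1 <= Sn%:R :> R by rewrite ler1n.
have [A A0 HA] := pade_system S1 den_le Hneg Hdiff alpha0.
have [D D0 HD] := uniform_denominator alpha.
set g := growth m Sn alpha in HA.
have g1 : 1 <= g by apply: growth_ge1.
have Umax1 : 1 <= g * D%:R by rewrite mulr_ege1 // ler1n.
have [H0 H00 Hpar] := choose_parameters m1 A0 Umax1.
exists H0 => // L iota a b HL ai bi b0 aE S e0 e1 e2 beta beta_int beta_nz H HH.
have [a' [b' [ai' bi' b0' aE' [bD bb]]]] := HD L iota a b HL ai bi b0 aE.
have b1 : 1 <= cmod (iota b') by apply: integer_norm_ge1.
have bb1 : 1 <= cmod (iota b) by apply: le_trans bb.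
pose U := g * cmod (iota b').
pose h j := Num.max 1 (cmod (iota (beta (lift ord0 j)))).
have hU : 1 <= U <= g * D%:R.
  by rewrite mulr_ege1 //= ler_wpM2l // (le_trans ler01).
have h1 j : 1 <= h j by rewrite le_max lexx.
have [X0 Y0 [N [n [n0 nN Hn Hfin]]]] := Hpar U h hU h1 HH.
rewrite -/H in X0 Y0 Hfin.
have [q [p [sq sp det0 Hq Hr]]] := HA N n n0 nN.
have U0 : 0 < U by lra.
have f0 k : (0 : R) < k`!%:R by rewrite ltr0n fact_gt0.
set Lam := (iota (beta ord0) + _).
have UN : U ^+ N = g ^+ N * cmod (iota b') ^+ N by apply: exprMn.
(* Each of the m summands is at most 1 / (2m) by the choice of n. *)
have Hsmall : cmod (iota b') ^+ N * (\sum_j h j * (A * N%:R * g ^+ N / (n j)`!%:R)) <= 2^-1.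
  rewrite mulr_sumr; apply: (@le_trans _ _ (\sum_(j < m) (2 * m%:R)^-1)).
    apply: ler_sum => j _.
    rewrite [leLHS](_ : _ = (A * N%:R * U ^+ N * h j) / (n j)`!%:R); last first.
      rewrite UN; move: (cmod _ ^+ N) (g ^+ N) (N%:R : R) ((n j)`!%:R^-1 : R) (h j) => *.
      by ring.
    have m2 : (0 : R) < 2 * m%:R by rewrite mulr_gt0 ?ltr0n.
    rewrite ler_pdivrMr // -(ler_pM2l m2) mulVKf ?gt_eqF //.
    by apply: le_trans (Hn j); rewrite le_eqVlt; apply/orP; left; apply/eqP; ring.
  rewrite sumr_const card_ord -[leLHS]mulr_natl invfM mulrCA mulfV ?mulr1 //.
  by rewrite pnatr_eq0 -lt0n.
have key : 2^-1 <= A * N`!%:R * U ^+ N * cmod Lam.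
  have hle j : cmod (iota (beta (lift ord0 j))) <= h j by rewrite /h le_max lexx orbT.
  have := linear_form_ge HL ai' bi' b0' aE' sq sp det0 Hq Hr beta_int beta_nz hle Hsmall.
  rewrite -/Lam [cmod _ ^+ N * _](_ : _ = A * N`!%:R * U ^+ N) //.
  by rewrite UN; move: (cmod _ ^+ N) (g ^+ N) => *; ring.
have Q0 : 0 < A * N`!%:R * U ^+ N by rewrite !mulr_gt0 ?exprn_gt0.
set X := ln H in X0 Y0 Hfin *.
have Hpos : 0 < H by apply: lt_le_trans HH.
set W := ln (2 * m%:R) + m.+1%:R * ln U + 1 in Hfin.
have WD : 2 * W <= 6 * (e0 + e1 * m%:R + e2 * m%:R ^+ 2).
  apply: log_constants_le => //; first by rewrite ln_ge0.
  have lg := @ln_growth R m Sn alpha S1.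
  rewrite /U lnM ?posrE; [|lra|lra].
  by rewrite [ln g]lg lerD2l ler_ln ?posrE //; lra.
rewrite /powR gt_eqF // -/X.
apply: (@le_lt_trans _ _ (expR (- (X + 2 * X / ln X * W)))).
  rewrite ler_expR mulrBl mulN1r opprD lerD2l lerN2.
  rewrite [leRHS](_ : _ = 6 * (e0 + e1 * m%:R + e2 * m%:R ^+ 2) * (X / ln X)); last by ring.
  rewrite [leLHS](_ : _ = 2 * W * (X / ln X)); last by ring.
  by rewrite ler_wpM2r // divr_ge0 // ltW.
have L0 : 0 < cmod Lam by rewrite -(pmulr_rgt0 _ Q0); lra.
rewrite expRN invf_plt ?posrE ?expR_gt0 //.
apply: le_lt_trans Hfin.
rewrite -[leLHS]mul1r ler_pdivrMr // -!(mulrA 2) -(ler_pM2l (_ : 0 < 2^-1)) ?invr_gt0 //.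
by rewrite mulr1 mulKf.
Qed.
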